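(* Suppose that the action of a group $G$ on a hyperbolic space $S$ is of general type and that the induced action of $G$ on the limit set $\Lambda_S(G)$ is faithful and not topologically free. Assume that $G$ acts faithfully and $3$-transitively on a set $\Omega$. Then there exists a $G$-orbit $\mathcal{O}\subset\Lambda_S(G)$ such that the actions of $G$ on $\Omega$ and on $\mathcal{O}$ are conjugate.
   Context: A hyperbolic space is a geodesic metric space $S$ (not assumed proper) such that for some $\delta\ge 0$, $\langle x|y\rangle_o\ge\min\{\langle x|z\rangle_o,\langle z|y\rangle_o\}-\delta$ for all $x,y,z,o\in S$, where $\langle x|y\rangle_o=\frac12(d(x,o)+d(y,o)-d(x,y))$. Its Gromov boundary $\partial S$ is the set of equivalence classes of sequences $(x_i)$ in $S$ with $\langle x_i|x_j\rangle_o\to\infty$ as $i,j\to\infty$, where $(x_i)\sim(y_i)$ iff $\langle x_i|y_j\rangle_o\to\infty$; a sequence in the class $a$ is said to converge to $a$. For $a,b\in\partial S$, $\langle a|b\rangle_o$ is the infimum of $\liminf_{i,j}\langle x_i|y_j\rangle_o$ over sequences $x_i\to a$, $y_j\to b$; $\partial S$ is topologized so that the sets $\{b\in\partial S:\langle a|b\rangle_o>r\}$, $r\ge 0$, form a neighborhood base at $a$. All group actions on hyperbolic spaces are by isometries; they extend to actions by homeomorphisms on $\partial S$. The limit set $\Lambda_S(G)\subseteq\partial S$ of a group $G$ acting on $S$ is the set of points of $\partial S$ that are limits of sequences in an orbit $Gs$ (independent of $s\in S$), with the subspace topology. An element $g\in G$ is loxodromic if $\langle g\rangle$ has unbounded orbits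 in $S$ and fixes exactly two points of $\partial S$. The action of $G$ on $S$ is of general type if its orbits are unbounded and $G$ contains two loxodromic elements with disjoint fixed point sets in $\partial S$. An action by homeomorphisms on a topological space $X$ is topologically free if for every nontrivial element $g$ the set of fixed points of $g$ in $X$ has empty interior. An action of $G$ on a set $\Omega$ is $k$-transitive if for any two $k$-tuples of distinct points $(\omega_1,\dots,\omega_k)$, $(v_1,\dots,v_k)$ of $\Omega$ there is $g\in G$ with $g\omega_i=v_i$ for all $i$. Two actions of $G$ on sets $\Omega$ and $\Omega'$ are conjugate if there is a bijective $G$-equivariant map $\Omega\to\Omega'$. *)

(* Defs.v *)
From HB Require Import structures.
From mathcomp Require Import all_boot all_order all_algebra.
From mathcomp Require Import all_classical all_reals all_analysis.

Set Implicit Arguments.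
Unset Strict Implicit.
Unset Printing Implicit Defensive.

Import Order.TTheory GRing.Theory Num.Theory.
Local Open Scope classical_set_scope.
Local Open Scope ring_scope.

(* The actions of [mathcomp.fingroup.action] are right actions of finite groups;
   these are left actions of an arbitrary group. *)
Record group_action (G : groupType) (X : Type) := GroupAction {
  act :> G -> X -> X;
  act1 : forall x, act 1%g x = x;
  actM : forall g h x, act (g * h)%g x = act g (act h x)
}.

Section Actions.
Variable G : groupType.

Definition action_orbit (X : Type) (a : group_action G X) (x : X) : set X :=
  [set a g x | g in [set: G]].

Definition fixed_points (X : Type) (a : group_action G X) (g : G) : set X :=
  [set x | a g x = x].

Definition faithful_action (X : Type) (a : group_action G X) : Prop :=
  forall g, (forall x, a g x = x) -> g = 1%g.

Definition k_transitive (k : nat) (X : Type) (a : group_action G X) : Prop :=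
  forall w v : 'I_k -> X, injective w -> injective v ->
    exists g, forall i, a g (w i) = v i.

Definition conjugate_actions (X Y : Type)
    (a : group_action G X) (b : group_action G Y) : Prop :=
  exists f : X -> Y, bijective f /\ forall g x, f (a g x) = b g (f x).

Definition topologically_free (X : topologicalType) (a : group_action G X) : Prop :=
  forall g, g <> 1%g -> (fixed_points a g)^° = set0.

Definition invariant_set (X : Type) (a : group_action G X) (A : set X) : Prop :=
  forall g x, A x -> A (a g x).

Section Restriction.
Variables (X : Type) (a : group_action G X) (A : set X).
Hypothesis Ainv : invariant_set a A.

Definition restrict_act (g : G) (x : A) : A :=
  exist _ (a g (set_val x)) (mem_set (Ainv g (set_valP x))).

Lemma restrict_act1 x : restrict_act 1%g x = x.
Proof. by apply: val_inj; rewrite /= act1. Qed.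

Lemma restrict_actM g h x :
  restrict_act (g * h)%g x = restrict_act g (restrict_act h x).
Proof. by apply: val_inj; rewrite /= actM. Qed.

Definition restrict_action : group_action G A :=
  GroupAction restrict_act1 restrict_actM.

End Restriction.

Lemma orbit_invariant (X : Type) (a : group_action G X) (x : X) :
  invariant_set a (action_orbit a x).
Proof. by move=> g _ [h _ <-]; exists (g * h)%g => //; rewrite actM. Qed.

Definition orbit_action (X : Type) (a : group_action G X) (x : X) :
    group_action G (action_orbit a x) :=
  restrict_action (@orbit_invariant X a x).

Definition cyclic_subgroup (g : G) : set G :=
  [set h | exists n : nat, h = (g ^+ n)%g \/ h = (g ^- n)%g].

End Actions.

Section Hyperbolic.
Context {R : realType}.
Variable S : metricType R.
Implicit Types (x y : nat -> S) (o p q : S).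

Definition geodesic_space : Prop :=
  forall p q, exists c : R -> S,
    [/\ c 0 = p, c (mdist p q) = q &
        forall s t, 0 <= s <= mdist p q -> 0 <= t <= mdist p q ->
          mdist (c s) (c t) = `|s - t| ].

Definition gromov_product o p q : R :=
  (mdist p o + mdist q o - mdist p q) / 2.

Definition hyperbolic_space : Prop :=
  geodesic_space /\
  exists2 delta : R, 0 <= delta &
    forall p q r o, Num.min (gromov_product o p r) (gromov_product o r q) - delta
                    <= gromov_product o p q.

Definition metric_bounded (A : set S) : Prop :=
  exists M : R, forall p q, A p -> A q -> mdist p q <= M.

(* The conditions below do not depend on the base point [o], which is why it is
   quantified over rather than fixed. *)
Definition asymptotic x y : Prop :=
  forall o, gromov_product o (x ij.1) (y ij.2) @[ij --> (\oo, \oo)] --> +oo.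

Definition converges_at_infinity x : Prop := asymptotic x x.

Definition asymptotic_class x : set (nat -> S) :=
  [set y | converges_at_infinity y /\ asymptotic x y].

Record boundary := Boundary {
  boundary_class : set (nat -> S);
  boundary_classP : exists2 x, converges_at_infinity x &
                      boundary_class = asymptotic_class x
}.

Definition converges_to x (a : boundary) : Prop := boundary_class a x.

Lemma boundary_inj (a b : boundary) : boundary_class a = boundary_class b -> a = b.
Proof.
by case: a => A Ap; case: b => B Bp /= AB; subst B; congr Boundary.
Qed.

Definition boundary_product o (a b : boundary) : \bar R :=
  ereal_inf [set l | exists x y, [/\ converges_to x a, converges_to y b &
    l = limf_einf (fun ij : nat * nat =>
                     (gromov_product o (x ij.1) (y ij.2))%:E)
                  (filter_prod \oo \oo)]].

Definition boundary_nbhd o (a : boundary) (r : R) : set boundary :=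
  [set b | (r%:E < boundary_product o a b)%E].

(* A topology in which the sets [boundary_nbhd o a r], r >= 0, form a
   neighborhood base at each [a] has exactly these open sets. *)
Definition boundary_open (U : set boundary) : Prop :=
  forall a, U a -> forall o, exists2 r : R, 0 <= r & boundary_nbhd o a r `<=` U.

Lemma boundary_openT : boundary_open setT.
Proof. by move=> a _ o; exists 0. Qed.

Lemma boundary_openI (U V : set boundary) :
  boundary_open U -> boundary_open V -> boundary_open (U `&` V).
Proof.
move=> oU oV a [Ua Va] o.
have [r r0 rU] := oU a Ua o; have [s s0 sV] := oV a Va o.
exists (Num.max r s); first by rewrite le_max r0.
by move=> b rsb; split; [apply: rU | apply: sV];
  apply: le_lt_trans rsb; rewrite lee_fin le_max lexx ?orbT.
Qed.

Lemma boundary_open_bigU (I : Type) (f : I -> set boundary) :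
  (forall i, boundary_open (f i)) -> boundary_open (\bigcup_i f i).
Proof.
move=> of_ a [i _ fia] o; have [r r0 rf] := of_ i a fia o.
by exists r => // b /rf fib; exists i.
Qed.

End Hyperbolic.

HB.instance Definition _ (R : realType) (S : metricType R) :=
  gen_eqMixin (boundary S).
HB.instance Definition _ (R : realType) (S : metricType R) :=
  gen_choiceMixin (boundary S).
HB.instance Definition _ (R : realType) (S : metricType R) :=
  isOpenTopological.Build (boundary S)
    (@boundary_openT R S) (@boundary_openI R S) (@boundary_open_bigU R S).

Record isometric_action (G : groupType) (R : realType) (S : metricType R) :=
  IsometricAction {
    isom_act :> group_action G S;
    isom_actP : forall g p q, mdist (isom_act g p) (isom_act g q) = mdist p q
  }.

Section IsometricActions.
Context {G : groupType} {R : realType} {S : metricType R}.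
Variable a : isometric_action G S.

Lemma actVK g p : a g^-1%g (a g p) = p.
Proof. by rewrite -actM mulVg act1. Qed.

Lemma actKV g p : a g (a g^-1%g p) = p.
Proof. by rewrite -actM mulgV act1. Qed.

Lemma asymptotic_act g (x y : nat -> S) :
  asymptotic x y -> asymptotic (fun i => a g (x i)) (fun i => a g (y i)).
Proof.
move=> xy o; suff -> : (fun ij : nat * nat =>
    gromov_product o (a g (x ij.1)) (a g (y ij.2))) =
  (fun ij => gromov_product (a g^-1%g o) (x ij.1) (y ij.2)) by exact: xy.
apply/funext => ij; rewrite /gromov_product isom_actP.
by rewrite -(isom_actP a g _ (a g^-1%g o)) -(isom_actP a g _ (a g^-1%g o)) actKV.
Qed.

Definition translate_class g (A : set (nat -> S)) : set (nat -> S) :=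
  [set (fun i => a g (x i)) | x in A].

Lemma translate_asymptotic_class g (x : nat -> S) :
  translate_class g (asymptotic_class x) = asymptotic_class (fun i => a g (x i)).
Proof.
rewrite eqEsubset; split => [_ [y [yy xy] <-]|y [yy xy]].
  by split; exact: asymptotic_act.
exists (fun i => a g^-1%g (y i)); last by apply/funext => i; rewrite actKV.
split; first exact: asymptotic_act.
have := asymptotic_act g^-1%g xy.
by congr asymptotic; apply/funext => i; rewrite actVK.
Qed.

Lemma translate_classP g (b : boundary S) :
  exists2 x, converges_at_infinity x &
    translate_class g (boundary_class b) = asymptotic_class x.
Proof.
case: (boundary_classP b) => x xx ->; exists (fun i => a g (x i)).
  exact: asymptotic_act.
exact: translate_asymptotic_class.
Qed.

Definition boundary_act g (b : boundary S) : boundary S :=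
  Boundary (translate_classP g b).

Lemma boundary_act1 b : boundary_act 1%g b = b.
Proof.
apply: boundary_inj => /=; rewrite /translate_class.
rewrite (_ : (fun x : nat -> S => _) = id) ?image_id//.
by apply/funext => x; apply/funext => i; rewrite act1.
Qed.

Lemma boundary_actM g h b :
  boundary_act (g * h)%g b = boundary_act g (boundary_act h b).
Proof.
apply: boundary_inj => /=; rewrite /translate_class image_comp.
congr (_ @` _).
by apply/funext => x; apply/funext => i; rewrite /= actM.
Qed.

Definition boundary_action : group_action G (boundary S) :=
  GroupAction boundary_act1 boundary_actM.

Definition limit_set : set (boundary S) :=
  [set b | exists s x, converges_to x b /\ forall i, action_orbit a s (x i)].

Lemma limit_set_invariant : invariant_set boundary_action limit_set.
Proof.
move=> g b [s [x [xb xs]]]; exists s, (fun i => a g (x i)); split.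
  by exists x.
by move=> i; exact: orbit_invariant.
Qed.

Definition limit_set_action : group_action G limit_set :=
  restrict_action limit_set_invariant.

Definition loxodromic (g : G) : Prop :=
  (forall s, ~ metric_bounded [set a h s | h in cyclic_subgroup g]) /\
  exists b c, b <> c /\
    \bigcap_(h in cyclic_subgroup g) fixed_points boundary_action h = [set b; c].

Definition general_type : Prop :=
  (forall s, ~ metric_bounded (action_orbit a s)) /\
  exists g h, [/\ loxodromic g, loxodromic h &
    fixed_points boundary_action g `&` fixed_points boundary_action h = set0].

End IsometricActions.

(* Main.v *)
(* Let H be the stabilizer of a point w of Omega. By 3-transitivity G = H u H g H
   and H = K u K h K for the stabilizer K of two points, so H and K are unbounded
   in S. If H fixes a limit point b, then H, being maximal, is the stabilizer of
   b, and w |-> b induces the required conjugacy.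
   Otherwise H contains a loxodromic element, and no H-invariant set C with two
   points avoids an open set of the limit set: one could find g such that gC is
   far from C, and the stabilizer of w and gw would coarsely fix the bridge
   between C and gC, hence be bounded. So H acts on the limit set with enough
   north-south dynamics to move the support of any element fixing an open set
   ("small" elements; nontrivial ones exist by assumption) into any prescribed
   ball. Separated sets satisfy the key rule [separated_cross]: if U1, U2 and W1,
   W2 are two separated pairs, then for every g some g Ui misses some Wj, so that
   elements supported there commute. Two contradictions follow from this mixed
   identity. If some nontrivial small element fixes a point of Omega, conjugate
   it to three elements fixing w and two elements moving w with pairwise
   separated supports. If none does, a small element is determined by its value
   at w, and transporting (w, a1 w, a2 w) to a suitable (w, b1 w, b2 w)
   contradicts the rule. *)
Require Import Defs.
From HB Require Import structures.
From mathcomp Require Import all_boot all_order all_algebra.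
From mathcomp Require Import all_classical all_reals all_analysis.
From mathcomp Require Import lra.

Set Implicit Arguments.
Unset Strict Implicit.
Unset Printing Implicit Defensive.

Import Order.TTheory GRing.Theory Num.Theory.
Local Open Scope classical_set_scope.
Local Open Scope ring_scope.

Section ActionInverses.
Context {G : groupType} {X : Type} (a : group_action G X).

Lemma actgK g x : a g^-1%g (a g x) = x.
Proof. by rewrite -actM mulVg act1. Qed.

Lemma actgKV g x : a g (a g^-1%g x) = x.
Proof. by rewrite -actM mulgV act1. Qed.

Lemma act_inj g : injective (a g).
Proof. by move=> x y /(congr1 (a g^-1%g)); rewrite !actgK. Qed.

Lemma fixedV g x : a g x = x -> a g^-1%g x = x.
Proof. by move=> gx; rewrite -{1}gx actgK. Qed.

End ActionInverses.

(** * Gromov products *)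

Section GromovProduct.
Context {R : realType} {S : metricType R}.
Implicit Types (o p q r : S) (x y : nat -> S).

Lemma gromov_sym o p q : gromov_product o p q = gromov_product o q p.
Proof. by rewrite /gromov_product metric_sym (metric_sym q p); lra. Qed.

Lemma gromov_ge0 o p q : 0 <= gromov_product o p q.
Proof.
rewrite /gromov_product; have := metric_triangle p o q.
by rewrite (metric_sym o q); lra.
Qed.

Lemma gromov_le o p q : gromov_product o p q <= mdist p o.
Proof.
rewrite /gromov_product; have := metric_triangle q p o.
by rewrite (metric_sym q p); lra.
Qed.

Lemma gromov_pp o p : gromov_product o p p = mdist p o.
Proof. by rewrite /gromov_product mdistxx; lra. Qed.

Lemma gromov_base o o' p q :
  gromov_product o p q - mdist o o' <= gromov_product o' p q.
Proof.
rewrite /gromov_product; have := metric_triangle p o' o; have := metric_triangle q o' o.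
by rewrite (metric_sym o' o); lra.
Qed.

Lemma gromov_lip o p q r :
  gromov_product o p r - mdist p q <= gromov_product o q r.
Proof.
rewrite /gromov_product; have := metric_triangle p q o.
have := metric_triangle q p r; rewrite (metric_sym q p); lra.
Qed.

Lemma asymptoticP o x y : asymptotic x y <->
  forall M, exists N, forall i j, (N <= i)%N -> (N <= j)%N ->
    M <= gromov_product o (x i) (y j).
Proof.
split=> [xy M|xy o'].
  have /cvgryPge/(_ M) [[A B] [[N _ NA] [N' _ NB]] AB] := xy o.
  exists (maxn N N') => i j; rewrite !geq_max => /andP[Ni Ni'] /andP[Nj Nj'].
  by apply: (AB (i, j)); split=> /=; [exact: NA|exact: NB].
apply/cvgryPge => M; have [N NP] := xy (M + mdist o o').
exists ([set i | (N <= i)%N], [set i | (N <= i)%N]) => /=.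
  by split; exists N.
move=> [i j] /= [Ni Nj]; have := NP i j Ni Nj.
by have := gromov_base o o' (x i) (y j); lra.
Qed.

End GromovProduct.

(* Boundary points are handled through the sequences representing them: the
   Gromov product of a boundary point [b] with [p : S] is only controlled up to
   a multiple of [delta], by the predicates [near_pt] and [far_pt]. *)
Section Geometry.
Context {R : realType} {S : metricType R} {G : groupType}.
Variables (aS : isometric_action G S) (o : S) (delta : R).
Implicit Types (p q : S) (x y z : nat -> S) (b c : boundary S) (g h : G) (r t M : R).
Hypothesis delta_gt0 : (0 : R) < delta.

Ltac dlra := have := delta_gt0; lra.

Notation "( p '|' q )" := (gromov_product o p q).
Notation len g := (mdist (aS g o) o).
Notation ab := (boundary_action aS).

(** The minimum in the four-point inequality becomes a disjunction, so that each use is a case split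
    closed by linear arithmetic at the cost of one [delta]. *)
Hypothesis gromov_or : forall p r q : S,
  (p | r) - delta <= (p | q) \/ (r | q) - delta <= (p | q).

Lemma isometry (g : G) (p q : S) : mdist (aS g p) (aS g q) = mdist p q.
Proof. exact: isom_actP. Qed.

Lemma len_inv (g : G) : len g^-1%g = len g.
Proof. by rewrite -(isometry g) (actgKV aS) metric_sym. Qed.

Lemma len_mul g h : len (g * h)%g <= len g + len h.
Proof.
rewrite actM; have := metric_triangle (aS g (aS h o)) (aS g o) o.
by rewrite isometry; dlra.
Qed.

Lemma len_mul_ge g h : len h - len g <= len (g * h)%g.
Proof. by have := len_mul g^-1%g (g * h)%g; rewrite mulKg len_inv; dlra. Qed.

(* The projection of [p] to a geodesic from [o] to [g^-1 o] splits it in two. *)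
Lemma gromov_act g p : (aS g p | aS g o) + (p | aS g^-1%g o) = len g.
Proof.
rewrite /gromov_product isometry -(isometry g p (aS g^-1%g o)) (actgKV aS).
by rewrite len_inv; dlra.
Qed.

Lemma gromov_act_ge g p q : (p | q) - len g <= (aS g p | aS g q).
Proof.
rewrite /gromov_product isometry.
have := metric_triangle (aS g^-1%g o) p o.
have := metric_triangle p (aS g^-1%g o) o; have := metric_triangle q (aS g^-1%g o) o.
by rewrite -(isometry g p (aS g^-1%g o)) -(isometry g q (aS g^-1%g o)) !(actgKV aS) len_inv; dlra.
Qed.

(** * Gromov products with boundary points *)

Definition near_pt (b : boundary S) (p : S) (r : R) : Prop :=
  forall x, converges_to x b -> \forall i \near \oo, r <= (x i | p).

Definition far_pt (b : boundary S) (p : S) (r : R) : Prop :=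
  forall x, converges_to x b -> \forall i \near \oo, (x i | p) <= r.

Definition far_apart (b c : boundary S) (r : R) : Prop :=
  forall x y, converges_to x b -> converges_to y c ->
    \forall i \near \oo, (x i | y i) <= r.

Lemma repr_ex (b : boundary S) : exists x, converges_to x b.
Proof. by case: (boundary_classP b) => x xx bE; exists x; rewrite /converges_to bE. Qed.

Lemma cvg_asymptotic x y z : asymptotic x y -> asymptotic y z -> asymptotic x z.
Proof.
move=> /(asymptoticP o) xy /(asymptoticP o) yz; apply/(asymptoticP o) => M.
have [N NP] := xy (M + delta); have [N' NP'] := yz (M + delta).
exists (maxn N N') => i j; rewrite !geq_max => /andP[Ni Ni'] /andP[Nj Nj'].
pose k := maxn N N'.
have := NP i k Ni (leq_maxl _ _); have := NP' k j (leq_maxr _ _) Nj'.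
by case: (gromov_or (x i) (y k) (z j)); dlra.
Qed.

Lemma asymptotic_sym x y : asymptotic x y -> asymptotic y x.
Proof.
move=> /(asymptoticP o) xy; apply/(asymptoticP o) => M; have [N NP] := xy M.
by exists N => i j Ni Nj; rewrite gromov_sym; exact: NP.
Qed.

Lemma reprs_asymptotic (b : boundary S) x y :
  converges_to x b -> converges_to y b -> asymptotic x y.
Proof.
case: (boundary_classP b) => z zz bE; rewrite /converges_to bE => -[_ zx] [_ zy].
exact: (cvg_asymptotic (asymptotic_sym zx) zy).
Qed.

Lemma asymptotic_eq (b c : boundary S) x y :
  converges_to x b -> converges_to y c -> asymptotic x y -> b = c.
Proof.
move=> xb yc xy; apply: boundary_inj; apply/seteqP; split => z.
- case: (boundary_classP c) (yc) => w ww cE.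
  move=> yc' zb; rewrite cE; move: yc'; rewrite /converges_to cE => -[yy wy].
  have xz := reprs_asymptotic xb zb.
  split; first exact: (reprs_asymptotic zb zb).
  exact: (cvg_asymptotic wy (cvg_asymptotic (asymptotic_sym xy) xz)).
- case: (boundary_classP b) (xb) => w ww bE.
  move=> xb' zc; rewrite bE; move: xb'; rewrite /converges_to bE => -[xx wx].
  split; first exact: (reprs_asymptotic zc zc).
  exact: (cvg_asymptotic wx (cvg_asymptotic xy (reprs_asymptotic yc zc))).
Qed.

Lemma limit_ex x : converges_at_infinity x -> exists b, converges_to x b.
Proof.
move=> xx; have E : exists2 y, converges_at_infinity y & asymptotic_class x = asymptotic_class y.
  by exists x.
by exists (Boundary E).
Qed.

Lemma converges_to_act g x b : converges_to x b -> converges_to (fun i => aS g (x i)) (ab g b).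
Proof. by move=> xb; exists x. Qed.

Lemma converges_to_actV g x b :
  converges_to x (ab g b) -> exists2 y, converges_to y b & x = (fun i => aS g (y i)).
Proof. by move=> [y yb <-]; exists y. Qed.

(** Two representatives of [b] have arbitrarily large products, so one whose products with [p] drop
    below [r] infinitely often controls all the others up to [delta]. *)
Lemma near_or_far b p r : near_pt b p r \/ far_pt b p (r + delta).
Proof.
have [|nP] := pselect (near_pt b p r); [by left|right].
move/existsNP : nP => [x /not_implyP[xb nP]] y yb.
have /(asymptoticP o)/(_ (r + delta + delta)) [N NP] := reprs_asymptotic yb xb.
have [k Nk kr] : exists2 k, (N <= k)%N & (x k | p) < r.
  apply: contrapT => C; apply: nP; exists N => // k /= Nk.
  by rewrite leNgt; apply/negP => ?; apply: C; exists k.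
exists N => // i /= Ni; have := NP i k Ni Nk; rewrite (gromov_sym o (y i)).
by case: (gromov_or (x k) (y i) p); dlra.
Qed.

Lemma far_apart_ex b c : b <> c -> exists r, far_apart b c r.
Proof.
have [x xb] := repr_ex b; have [y yc] := repr_ex c => bc.
have : ~ asymptotic x y by move=> xy; exact/bc/(asymptotic_eq xb yc xy).
move=> /(asymptoticP o)/existsNP[M /forallNP C].
exists (M + delta + delta) => x' y' x'b y'c.
have /(asymptoticP o)/(_ (M + delta + delta)) [N NP] := reprs_asymptotic x'b xb.
have /(asymptoticP o)/(_ (M + delta + delta)) [N' NP'] := reprs_asymptotic y'c yc.
exists (maxn N N') => // i /=; rewrite geq_max => /andP[Ni Ni'].
have /existsNP[k /existsNP[l /not_implyP[Nk /not_implyP[Nl /negP]]]] := C (maxn N N').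
move: Nk Nl; rewrite !geq_max => /andP[Nk _] /andP[_ Nl]; rewrite -ltNge.
have := NP _ _ Ni Nk; have := NP' _ _ Ni' Nl; rewrite (gromov_sym o (x' i) (x k)).
by case: (gromov_or (x k) (x' i) (y l)); case: (gromov_or (x' i) (y' i) (y l)); dlra.
Qed.

Lemma far_apart_sym b c r : far_apart b c r -> far_apart c b r.
Proof.
move=> bc x y xc yb; apply: filterS (bc y x yb xc) => i; by rewrite gromov_sym.
Qed.

Lemma far_apart_le b c r r' : far_apart b c r -> r <= r' -> far_apart b c r'.
Proof. by move=> bc rr' x y xb yc; apply: filterS (bc _ _ xb yc) => i; dlra. Qed.

Lemma far_apart_neq b c r : far_apart b c r -> b <> c.
Proof.
move=> bc E; subst c; have [x xb] := repr_ex b.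
have /(asymptoticP o)/(_ (r + 1)) [N NP] := reprs_asymptotic xb xb.
have [N' _ NP'] := bc _ _ xb xb.
have := NP _ _ (leq_maxl N N') (leq_maxl N N'); have := NP' _ (leq_maxr N N') => /=.
by dlra.
Qed.

Lemma near_pt_le b p r r' : near_pt b p r -> r' <= r -> near_pt b p r'.
Proof. by move=> bp rr' x xb; apply: filterS (bp _ xb) => i; dlra. Qed.

Lemma far_pt_le b p r r' : far_pt b p r -> r <= r' -> far_pt b p r'.
Proof. by move=> bp rr' x xb; apply: filterS (bp _ xb) => i; dlra. Qed.

(** The contraction behind all the dynamics: by [gromov_act], [g] pushes whatever is not close to
    [g^-1 o] towards [g o]. *)
Lemma near_pt_inv b g r : far_pt b (aS g^-1%g o) r -> near_pt (ab g b) (aS g o) (len g - r).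
Proof.
move=> bg _ /converges_to_actV[x xb ->]; apply: filterS (bg _ xb) => i.
by have := gromov_act g (x i); dlra.
Qed.

Lemma near_pt_act g b p r : near_pt b p r -> near_pt (ab g b) (aS g p) (r - len g).
Proof.
move=> bp _ /converges_to_actV[x xb ->]; apply: filterS (bp _ xb) => i.
by have := gromov_act_ge g (x i) p; dlra.
Qed.

Lemma gromov_act_le g p q : (aS g p | aS g q) <= (p | q) + len g.
Proof. by have := gromov_act_ge g^-1%g (aS g p) (aS g q); rewrite !(actgK aS) len_inv; dlra. Qed.

Lemma far_pt_act g b p r : far_pt b p r -> far_pt (ab g b) (aS g p) (r + len g).
Proof.
move=> bp _ /converges_to_actV[x xb ->]; apply: filterS (bp _ xb) => i.
by have := gromov_act_le g (x i) p; dlra.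
Qed.

Lemma far_apart_act g b c r : far_apart b c r -> far_apart (ab g b) (ab g c) (r + len g).
Proof.
move=> bc _ _ /converges_to_actV[x xb ->] /converges_to_actV[y yc ->].
by apply: filterS (bc _ _ xb yc) => i; have := gromov_act_le g (x i) (y i); dlra.
Qed.

(** From here to [near_near_neq], facts that are exact in a tree are transcribed with one [delta]
    per use of [gromov_or]; gaps such as [t + delta < r] exclude the wrong branch of the
    disjunction. *)
Lemma near_pt_gt b p q r t : near_pt b p r -> (p | q) <= t -> t + delta < r ->
  far_pt b q (t + delta).
Proof.
move=> bp pq tr x xb; apply: filterS (bp _ xb) => i; rewrite gromov_sym.
by case: (gromov_or p (x i) q); dlra.
Qed.

Lemma near_pt_trans b p q r : near_pt b p r -> r <= (p | q) -> near_pt b q (r - delta).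
Proof.
move=> bp pq x xb; apply: filterS (bp _ xb) => i.
by case: (gromov_or (x i) p q); dlra.
Qed.

Lemma near_far_apart b c p r t : near_pt b p r -> far_apart b c t -> t + delta < r ->
  far_pt c p (t + delta).
Proof.
move=> bp bc tr y yc; have [x xb] := repr_ex b.
apply: filterS2 (bp _ xb) (bc _ _ xb yc) => i; rewrite (gromov_sym o (y i)).
by case: (gromov_or (x i) p (y i)); rewrite gromov_sym; dlra.
Qed.

Lemma near_near_apart b c p q r r' t : near_pt b p r -> near_pt c q r' -> (p | q) <= t ->
  t + delta + delta < r -> t + delta + delta < r' -> far_apart b c (t + delta + delta).
Proof.
move=> bp cq pq tr tr' x y xb yc; apply: filterS2 (bp _ xb) (cq _ yc) => i.
rewrite (gromov_sym o (x i) p).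
by case: (gromov_or p (x i) q); case: (gromov_or (x i) (y i) q); dlra.
Qed.

Lemma far_apart_near_le b c p q r r' t : near_pt b p r -> near_pt c q r' -> far_apart b c t ->
  t + delta + delta < r -> t + delta + delta < r' -> (p | q) <= t + delta + delta.
Proof.
move=> bp cq bc tr tr'; have [x xb] := repr_ex b; have [y yc] := repr_ex c.
have F : \forall i \near \oo, (p | q) <= t + delta + delta.
  apply: filterS3 (bp _ xb) (cq _ yc) (bc _ _ xb yc) => i.
  rewrite (gromov_sym o (y i) q).
  by case: (gromov_or (x i) p (y i)); case: (gromov_or p q (y i)); dlra.
by have [N _ /(_ N) /=] := F; apply.
Qed.

Lemma near_near_neq b c p r t : near_pt b p r -> near_pt c p r -> far_apart b c t ->
  r <= t + delta.
Proof.
move=> bp cp bc; have [x xb] := repr_ex b; have [y yc] := repr_ex c.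
have F : \forall i \near \oo, r <= t + delta.
  apply: filterS3 (bp _ xb) (cp _ yc) (bc _ _ xb yc) => i.
  by rewrite (gromov_sym o (y i)); case: (gromov_or (x i) p (y i)); dlra.
by have [N _ /(_ N) /=] := F; apply.
Qed.


Implicit Types (s : G).

(** * Dynamics of subgroups on the boundary *)

Definition subgroup (H : set G) : Prop :=
  [/\ H 1%g, forall g h, H g -> H h -> H (g * h)%g & forall g, H g -> H g^-1%g].

(** A substitute for missing a neighborhood of a limit point of [H], phrased with orbit points only.
    The bound [r] is chosen before [M]. *)
Definition small (H : set G) (C : set (boundary S)) : Prop :=
  exists r, forall M, exists g : G,
    [/\ H g, M <= len g & forall b, C b -> far_pt b (aS g o) r].

Definition orbit_limit (H : set G) (b : boundary S) : Prop :=
  forall M, exists2 g, H g & near_pt b (aS g o) M.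

(** Imitates the attracting point [b] and the repelling point [c] of a loxodromic element, with [g]
    allowed to vary with [M]. *)
Definition axial (H : set G) (b c : boundary S) : Prop :=
  forall M, exists g, [/\ H g, near_pt b (aS g o) M & near_pt c (aS g^-1%g o) M].

(** A supply of corrections of bounded length: [s] turns [q] away from [p], so that geodesics from
    [o] to [p] and to [s q] diverge at a bounded distance from [o]. *)
Definition rich (H : set G) : Prop :=
  exists L r, forall p q, exists s, [/\ H s, len s <= L & (p | aS s q) <= r].

Definition directions (H : set G) (n : nat) : Prop :=
  exists r, forall M, exists t : 'I_n -> G,
    [/\ forall i, H (t i), forall i, M <= len (t i) &
        forall i j, i != j -> (aS (t i) o | aS (t j) o) <= r].

Lemma near_pt_len b p r : near_pt b p r -> r <= mdist p o.
Proof.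
move=> bp; have [x xb] := repr_ex b; have [N _ /(_ N) /=] := bp _ xb.
by move=> /(_ (leqnn _)); rewrite gromov_sym; have := gromov_le o p (x N); dlra.
Qed.

Lemma axial_limitl H b c : axial H b c -> orbit_limit H b.
Proof. by move=> bc M; have [g [Hg bg _]] := bc M; exists g. Qed.

Lemma axial_sym H b c : subgroup H -> axial H b c -> axial H c b.
Proof.
move=> [_ _ HV] bc M; have [g [Hg bg cg]] := bc M; exists g^-1%g.
by split; rewrite ?invgK//; exact: HV.
Qed.

Lemma orbit_limit_act H (t : G) b : subgroup H -> H t ->
  orbit_limit H b -> orbit_limit H (ab t b).
Proof.
move=> [_ HM _] Ht bH M; have [g Hg bg] := bH (M + len t).
exists (t * g)%g; first exact: HM.
by rewrite actM; apply: near_pt_le (near_pt_act (g := t) bg) _; dlra.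
Qed.

Lemma small_sub H C C' : C' `<=` C -> small H C -> small H C'.
Proof.
move=> C'C [r Cr]; exists r => M; have [g [Hg gM gC]] := Cr M.
by exists g; split => // b /C'C; exact: gC.
Qed.

Lemma small_act C g : small [set: G] C -> small [set: G] [set ab g b | b in C].
Proof.
move=> [r Cr]; exists (r + len g) => M; have [h [_ hM hC]] := Cr (M + len g).
exists (g * h)%g; split => //; first by have := len_mul_ge g h; dlra.
by move=> _ [b Cb <-]; rewrite actM; exact: (far_pt_act (g := g) (hC _ Cb)).
Qed.

(** Since [q] is away from [g^-1 o], the point [g q] is close to [b] and [t g q] is close to [t b].
    As [b] and [t b] are far apart, [p] cannot be close to both. *)
Lemma axial_rich_half b (t : G) r g p q M : far_apart b (ab t b) r -> 0 <= r ->
  near_pt b (aS g o) M -> 2 * r + 7 * delta + len t <= M ->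
  (q | aS g^-1%g o) <= r + 3 * delta ->
  (p | aS g q) <= r + 3 * delta \/ (p | aS (t * g)%g q) <= r + 3 * delta.
Proof.
move=> btb r0 bg rM qg.
have lg := near_pt_len bg.
have tl := mdist_ge0 (aS t o) o.
have gq := gromov_act g q.
have bq : near_pt b (aS g q) (M - r - 4 * delta).
  apply: near_pt_le (@near_pt_trans _ _ _ (M - r - 3 * delta) (near_pt_le bg _) _) _.
  - by dlra.
  - by rewrite gromov_sym; dlra.
  - by dlra.
have tbq := near_pt_act (g := t) bq.
rewrite actM.
have := far_apart_near_le bq tbq btb.
have [|] := leP (p | aS g q) (r + 3 * delta); first by left.
have [|] := leP (p | aS t (aS g q)) (r + 3 * delta); first by right.
rewrite (gromov_sym o p (aS g q)) => h1 h2 h3.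
have := h3 _ _; case: (gromov_or (aS g q) p (aS t (aS g q))).
  by move=> h4 /(_ ltac:(dlra) ltac:(dlra)); dlra.
by move=> h4 /(_ ltac:(dlra) ltac:(dlra)); dlra.
Qed.

(** As [b] and [c] are far apart, [q] is away from [g o] or from [g^-1 o]; the previous lemma
    applies to [g^-1] and [c], or to [g] and [b]. The candidates for [s] are [g], [t g], [g^-1] and
    [t' g^-1]. *)
Lemma axial_rich H b c (t t' : G) : subgroup H -> axial H b c -> b <> c ->
  H t -> ab t b <> b -> H t' -> ab t' c <> c -> rich H.
Proof.
move=> [_ HM HV] bcH bc Ht tb Ht' t'c.
have [r1 bc1] := far_apart_ex bc.
have [r2 tb2] := far_apart_ex (fun E => tb (esym E)).
have [r3 tc3] := far_apart_ex (fun E => t'c (esym E)).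
pose r := `|r1| + `|r2| + `|r3|.
have r0 : 0 <= r by rewrite /r !addr_ge0.
have [n1 n2 n3] : [/\ r1 <= r, r2 <= r & r3 <= r].
  rewrite /r; split; have := ler_norm r1; have := ler_norm r2; have := ler_norm r3;
    have := normr_ge0 r1; have := normr_ge0 r2; have := normr_ge0 r3; lra.
have bcr := far_apart_le bc1 n1; have tbr := far_apart_le tb2 n2.
have tcr := far_apart_le tc3 n3.
have tl := mdist_ge0 (aS t o) o; have tl' := mdist_ge0 (aS t' o) o.
have [g [Hg bg cg]] := bcH (2 * r + 7 * delta + len t + len t').
exists (len g + len t + len t'), (r + 3 * delta) => p q.
have gg : (aS g o | aS g^-1%g o) <= r + delta + delta.
  by apply: (far_apart_near_le bg cg bcr); dlra.
have lg := len_inv g; have gl := mdist_ge0 (aS g o) o.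
have [qg|qg] := leP (q | aS g^-1%g o) (r + 3 * delta).
  have [] := axial_rich_half p tbr r0 bg _ qg; first by dlra.
    by exists g; split => //; dlra.
  exists (t * g)%g; split => //; first exact: HM.
  by have := len_mul t g; dlra.
have {}qg : (q | aS g^-1%g^-1%g o) <= r + 3 * delta.
  by rewrite invgK gromov_sym; case: (gromov_or (aS g o) q (aS g^-1%g o)); dlra.
have [] := axial_rich_half p tcr r0 cg _ qg; first by dlra.
  by exists g^-1%g; split => //; [exact: HV|dlra].
exists (t' * g^-1)%g; split => //; first by apply: HM => //; exact: HV.
by have := len_mul t' g^-1%g; dlra.
Qed.

(** [g^-1] carries [C] close to [g^-1 o], a short [s] turns this away from [t^-1 o], and [t] then
    pushes it close to [t o]. The loss [r] comes from richness alone, so it is the same for all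
    [C]. *)
Lemma small_contract H : subgroup H -> rich H -> exists r, forall C, small H C ->
  forall t : G, H t -> exists2 h, H h & forall b, C b -> near_pt (ab h b) (aS t o) (len t - r).
Proof.
move=> [_ HM HV] [L [r HL]]; exists (r + delta) => C [rho Crho] t Ht.
have [g [Hg gM gC]] := Crho (rho + L + r + 2 * delta).
have [s [Hs sL sr]] := HL (aS t^-1%g o) (aS g^-1%g o).
exists (t * (s * g^-1))%g; first exact: (HM _ _ Ht (HM _ _ Hs (HV _ Hg))).
move=> b /gC gb; rewrite (actM ab t) (actM ab s); apply: near_pt_inv.
have bg : near_pt (ab g^-1%g b) (aS g^-1%g o) (len g^-1%g - rho).
  by apply: near_pt_inv; rewrite invgK.
apply: (near_pt_gt (near_pt_act (g := s) bg)); first by rewrite gromov_sym.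
by rewrite len_inv; dlra.
Qed.

(** * Separated sets and the placement of small sets *)

(** Comparing two sums of opposite distances involves no base point, so this condition is exactly
    invariant under isometries, whereas the bound in [far_apart] degrades with [len g]. *)
Definition separated (U V : set (boundary S)) : Prop :=
  forall u u' v v', U u -> U u' -> V v -> V v' ->
  forall x x' y y', converges_to x u -> converges_to x' u' ->
    converges_to y v -> converges_to y' v' ->
  \forall i \near \oo, mdist (x i) (x' i) + mdist (y i) (y' i) <
                       mdist (x i) (y i) + mdist (x' i) (y' i).

Lemma mdist_gromov p q : mdist p q = mdist p o + mdist q o - 2 * (p | q).
Proof. by rewrite /gromov_product; lra. Qed.

Lemma near_separated (U V : set (boundary S)) p q r (t : R) :
  (forall u, U u -> near_pt u p r) -> (forall v, V v -> near_pt v q r) ->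
  (p | q) <= t -> t + 3 * delta < r -> separated U V.
Proof.
move=> Up Vq pq tr u u' v v' Uu Uu' Vv Vv' x x' y y' xu xu' yv yv'.
apply: filterS2 (filterI (Up _ Uu _ xu) (Up _ Uu' _ xu'))
  (filterI (Vq _ Vv _ yv) (Vq _ Vv' _ yv')) => i [xp x'p] [yq y'q].
have far1 (z w : S) : r <= (z | p) -> r <= (w | q) -> (z | w) <= t + 2 * delta.
  rewrite (gromov_sym o z) => zp wq.
  by case: (gromov_or p z q); case: (gromov_or z w q); dlra.
have near1 (z w p' : S) : r <= (z | p') -> r <= (w | p') -> r - delta <= (z | w).
  rewrite (gromov_sym o w) => zp wq.
  by case: (gromov_or z p' w); dlra.
(* The distances to [o] cancel. What remains compares products inside [U] and [V], at least
   [r - delta], with products across, at most [t + 2 * delta]. *)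
rewrite (mdist_gromov (x i) (x' i)) (mdist_gromov (y i) (y' i)).
rewrite (mdist_gromov (x i) (y i)) (mdist_gromov (x' i) (y' i)).
have := far1 _ _ xp yq; have := far1 _ _ x'p y'q.
by have := near1 _ _ _ xp x'p; have := near1 _ _ _ yq y'q; dlra.
Qed.

(** [N i] is the shadow of [t i o]: the points whose product with it falls short of [len (t i)] by
    at most [R1]. The margin [R1] absorbs both the loss of [small_contract] and the richness
    bound. *)
Lemma placement H n : subgroup H -> rich H -> directions H n ->
  exists N : 'I_n -> set (boundary S),
  [/\ forall i j, i != j -> separated (N i) (N j),
      forall i C, small H C -> exists2 h, H h & forall b, C b -> N i (ab h b) &
      forall i, small H (~` N i)].
Proof.
move=> sH rH [r Hr]; have [HC hC] := small_contract sH rH.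
have [L [R0 HL]] := rH; case: (sH) => _ HM HV.
pose R1 := `|HC| + `|R0| + 3 * delta.
have n1 := ler_norm HC; have n2 := ler_norm R0.
have m1 := normr_ge0 HC; have m2 := normr_ge0 R0.
have [t [Ht tM tr]] := Hr (r + R1 + 4 * delta).
exists (fun i b => near_pt b (aS (t i) o) (len (t i) - R1)); split.
- move=> i j ij; apply: (near_separated (r := r + 4 * delta) _ _ (tr _ _ ij)); last by dlra.
  + by move=> u /near_pt_le; apply; have := tM i; rewrite /R1; dlra.
  + by move=> u /near_pt_le; apply; have := tM j; rewrite /R1; dlra.
- move=> i C sC; have [h Hh hb] := hC C sC _ (Ht i); exists h => // b Cb.
  by apply: near_pt_le (hb b Cb) _; rewrite /R1; dlra.
- move=> i; exists (len (t i) - R1 + 2 * delta) => M.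
  (* A long [v i], turned by [s] away from [(t i)^-1 o], puts the orbit point of [t i * (s * v i)]
     deep in the shadow of [t i o], hence away from the complement of [N i]. *)
  have [v [Hv vM _]] := Hr (M + len (t i) + L).
  have [s [Hs sL sR]] := HL (aS (t i)^-1%g o) (aS (v i) o).
  have e1 := len_mul_ge (t i) (s * v i)%g; have e2 := len_mul_ge s (v i).
  have := vM i => e3; exists (t i * (s * v i))%g; split;
    first exact: (HM _ _ (Ht i) (HM _ _ Hs (Hv i))).
    by dlra.
  move=> b /= bN; have [//|fb] := near_or_far b (aS (t i) o) (len (t i) - R1).
  move=> x xb; apply: filterS (fb _ xb) => k.
  have := gromov_act (t i) (aS (s * v i)%g o); rewrite !actM.
  rewrite (gromov_sym o (aS s _)) => e4.
  by case: (gromov_or (x k) (aS (t i) (aS s (aS (v i) o))) (aS (t i) o)); rewrite /R1; dlra.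
Qed.

Lemma uniform_far (s : seq (boundary S)) :
  exists r, forall b c, b \in s -> c \in s -> b <> c -> far_apart b c r.
Proof.
have /boolp.choice[f fP] : forall bc : boundary S * boundary S,
    exists r, bc.1 <> bc.2 -> far_apart bc.1 bc.2 r.
  move=> [b c] /=; have [->|/far_apart_ex[r br]] := pselect (b = c).
    by exists 0.
  by exists r.
exists (\sum_(b <- s) \sum_(c <- s) `|f (b, c)|) => b c bs cs bc.
apply: far_apart_le (fP (b, c) bc) _; apply: le_trans (ler_norm _) _.
rewrite (big_rem b)//= (big_rem c)//= -addrA lerDl addr_ge0 ?sumr_ge0// => *.
by rewrite sumr_ge0.
Qed.

Lemma orbit_limit_directions H n (d : 'I_n -> boundary S) : injective d ->
  (forall i, orbit_limit H (d i)) -> directions H n.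
Proof.
move=> dI dH; have [r rP] := uniform_far [seq d i | i <- enum 'I_n].
exists (r + delta + delta) => M.
have /boolp.choice[t tP] : forall i, exists t : G,
    H t /\ near_pt (d i) (aS t o) (`|M| + `|r| + 3 * delta).
  by move=> i; have [g Hg gd] := dH i (`|M| + `|r| + 3 * delta); exists g.
have n1 := ler_norm M; have n2 := ler_norm r.
have m1 := normr_ge0 M; have m2 := normr_ge0 r.
exists t; split=> [i|i|i j ij]; first by case: (tP i).
  by have := near_pt_len (tP i).2; dlra.
apply: (far_apart_near_le (tP i).2 (tP j).2); try by dlra.
by apply: rP; rewrite ?map_f ?mem_enum// => /dI/eqP; rewrite (negPf ij).
Qed.

(* If the limit set were finite, an element [g] sending [o] deep towards one
   limit point would send two of three limit points to that same point. *)
Lemma orbit_limit_infinite H b c d : subgroup H ->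
  orbit_limit H b -> orbit_limit H c -> orbit_limit H d ->
  b <> c -> b <> d -> c <> d -> infinite_set (orbit_limit H).
Proof.
move=> sH Hb Hc Hd bc bd cd /finite_seqP[s sE].
have inS e : (e \in s) <-> orbit_limit H e by rewrite sE.
have [r rP] := uniform_far s.
have n2 := ler_norm r; have m2 := normr_ge0 r.
have [g Hg bg] := Hb (2 * `|r| + 5 * delta).
have lg := near_pt_len bg.
have fixb e : orbit_limit H e -> far_pt e (aS g^-1%g o) (r + 2 * delta + delta) -> ab g e = b.
  move=> He eg; apply: contrapT => geb.
  have bge : far_apart b (ab g e) r.
    apply: rP; [exact/inS|apply/inS; exact: orbit_limit_act|exact/nesym].
  have n1 : near_pt b (aS g o) (r + 2 * delta) by apply: near_pt_le bg _; dlra.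
  have n3 : near_pt (ab g e) (aS g o) (r + 2 * delta).
    by apply: near_pt_le (near_pt_inv eg) _; dlra.
  by have := near_near_neq n1 n3 bge; dlra.
have two e e' : orbit_limit H e -> orbit_limit H e' -> e <> e' ->
    near_pt e (aS g^-1%g o) (r + 2 * delta) -> near_pt e' (aS g^-1%g o) (r + 2 * delta) -> False.
  move=> He He' ee' n1 n3; have f : far_apart e e' r by apply: rP => //; exact/inS.
  by have := near_near_neq n1 n3 f; dlra.
have eq e e' : e <> e' -> ab g e = b -> ab g e' = b -> False.
  by move=> ee' geb; rewrite -geb => /(@act_inj _ _ ab)/esym.
have [nb|/(fixb _ Hb) fb] := near_or_far b (aS g^-1%g o) (r + 2 * delta).
  have [/(two _ _ Hb Hc bc nb)//|/(fixb _ Hc) fc] := near_or_far c (aS g^-1%g o) (r + 2 * delta).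
  have [/(two _ _ Hb Hd bd nb)//|/(fixb _ Hd) fd] := near_or_far d (aS g^-1%g o) (r + 2 * delta).
  exact: eq cd fc fd.
have [nc|/(fixb _ Hc) fc] := near_or_far c (aS g^-1%g o) (r + 2 * delta); last exact: eq bc fb fc.
have [/(two _ _ Hc Hd cd nc)//|/(fixb _ Hd) fd] := near_or_far d (aS g^-1%g o) (r + 2 * delta).
exact: eq bd fb fd.
Qed.

(** Among [x1, x2] or among [y1, y2], both points are away from [P = k^-1 o], because [P] cannot be
    close to an [x] and to a [y]. The images of such a pair both follow [k o] for almost [len k],
    while their product is at most [t]. *)
Lemma bridge_pts k (r t : R) (x1 x2 y1 y2 : S) :
  (x1 | y1) <= r -> (x1 | y2) <= r -> (x2 | y1) <= r -> (x2 | y2) <= r ->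
  (aS k x1 | aS k x2) <= t -> (aS k y1 | aS k y2) <= t -> len k <= t + r + 2 * delta.
Proof.
move=> x1y1 x1y2 x2y1 x2y2 kx ky.
have ex1 := gromov_act k x1; have ex2 := gromov_act k x2.
have ey1 := gromov_act k y1; have ey2 := gromov_act k y2.
set P := aS k^-1%g o in ex1 ex2 ey1 ey2.
have away (x y : S) : (x | y) <= r -> r + delta < (x | P) -> (y | P) <= r + delta.
  by rewrite (gromov_sym o y) => xy xP; case: (gromov_or x P y); dlra.
have wide (x y : S) : (x | P) <= r + delta -> (y | P) <= r + delta ->
    (aS k x | aS k y) <= t -> (aS k x | aS k o) + (x | P) = len k ->
    (aS k y | aS k o) + (y | P) = len k -> len k <= t + r + 2 * delta.
  rewrite (gromov_sym o (aS k y) (aS k o)) => xP yP xy ex ey.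
  by case: (gromov_or (aS k x) (aS k o) (aS k y)); dlra.
have [h1|/[dup] /(away _ _ x1y1) h2 /(away _ _ x1y2) h3]
  := leP (x1 | P) (r + delta); last
  exact: wide h2 h3 ky ey1 ey2.
have [h4|/[dup] /(away _ _ x2y1) h2 /(away _ _ x2y2) h3]
  := leP (x2 | P) (r + delta); last
  exact: wide h2 h3 ky ey1 ey2.
exact: wide h1 h4 kx ex1 ex2.
Qed.

(* [K] coarsely fixes the bridge between two invariant sets with at least two
   points each. *)
Lemma bridge (K : set G) (C C' : set (boundary S)) (b1 b2 c1 c2 : boundary S) r t :
  (forall k b, K k -> C b -> C (ab k^-1%g b)) ->
  (forall k c, K k -> C' c -> C' (ab k^-1%g c)) ->
  (forall b c, C b -> C' c -> far_apart b c r) ->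
  C b1 -> C b2 -> C' c1 -> C' c2 -> far_apart b1 b2 t -> far_apart c1 c2 t ->
  forall k, K k -> len k <= t + r + 2 * delta.
Proof.
move=> KC KC' CC' Cb1 Cb2 Cc1 Cc2 b12 c12 k Kk.
have [x1 x1b] := repr_ex (ab k^-1%g b1); have [x2 x2b] := repr_ex (ab k^-1%g b2).
have [y1 y1c] := repr_ex (ab k^-1%g c1); have [y2 y2c] := repr_ex (ab k^-1%g c2).
have act_repr z b : converges_to z (ab k^-1%g b) -> converges_to (fun i => aS k (z i)) b.
  by move=> /(converges_to_act k); rewrite (actgKV ab).
have Cx1 := KC _ _ Kk Cb1; have Cx2 := KC _ _ Kk Cb2.
have Cy1 := KC' _ _ Kk Cc1; have Cy2 := KC' _ _ Kk Cc2.
have [N _ /(_ N (leqnn N))] := filterI (filterI (filterI (CC' _ _ Cx1 Cy1 _ _ x1b y1c)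
  (CC' _ _ Cx1 Cy2 _ _ x1b y2c)) (filterI (CC' _ _ Cx2 Cy1 _ _ x2b y1c)
  (CC' _ _ Cx2 Cy2 _ _ x2b y2c))) (filterI (b12 _ _ (act_repr _ _ x1b) (act_repr _ _ x2b))
  (c12 _ _ (act_repr _ _ y1c) (act_repr _ _ y2c))).
by move=> /= [[[h1 h2] [h3 h4]] [h5 h6]]; exact: bridge_pts h1 h2 h3 h4 h5 h6.
Qed.

Lemma asymptotic_converges x y b : converges_to x b -> asymptotic x y -> converges_to y b.
Proof.
case: (boundary_classP b) => z zz bE; rewrite /converges_to bE => -[xx zx] xy.
split; last exact: (cvg_asymptotic zx xy).
exact: (cvg_asymptotic (asymptotic_sym xy) xy).
Qed.

Lemma near_pt_limit x b p r n : converges_to x b ->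
  (forall i, (n <= i)%N -> r <= (x i | p)) -> near_pt b p (r - delta).
Proof.
move=> xb xp y yb.
have /(asymptoticP o)/(_ r) [N NP] := reprs_asymptotic yb xb.
exists N => // i /= Ni; have := NP i (maxn N n) Ni (leq_maxl _ _).
have := xp (maxn N n) (leq_maxr _ _).
by case: (gromov_or (y i) (x (maxn N n)) p); dlra.
Qed.

Lemma orbit_limit_limit_set H b : orbit_limit H b -> limit_set aS b.
Proof.
move=> bH; have [x xb] := repr_ex b.
have /boolp.choice[g gP] : forall n : nat, exists g : G, near_pt b (aS g o) n%:R.
  by move=> n; have [g _ gn] := bH n%:R; exists g.
exists o, (fun n => aS (g n) o); split; last by move=> i; exists (g i).
apply: (asymptotic_converges xb); apply/(asymptoticP o) => M.
have /(asymptoticP o)/(_ (M + delta)) [N NP] := reprs_asymptotic xb xb.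
pose N' := Num.bound (`|M| + delta).
have N'P : M + delta < N'%:R.
  have := archi_boundP (addr_ge0 (normr_ge0 M) (ltW delta_gt0)).
  by rewrite -/N'; have := ler_norm M; dlra.
exists (maxn N N') => i j; rewrite !geq_max => /andP[Ni Ni'] /andP[Nj Nj'].
have [n _ nP] := gP j _ xb; have := nP (maxn N n) (leq_maxr _ _) => /=.
have := NP i (maxn N n) Ni (leq_maxl _ _).
have : N'%:R <= j%:R :> R by rewrite ler_nat.
by case: (gromov_or (x i) (x (maxn N n)) (aS (g j) o)); dlra.
Qed.

(** * Loxodromic elements *)

Section Hyperbolic.
Variable f : G.
(** [beta] measures the backtracking of the orbit of [f]. When the displacement exceeds twice this
    amount with enough slack, every further power gains at least [delta] in length. *)
Let beta := (aS f o | aS f^-1%g o).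
Hypothesis f_hyp : 2 * beta + 3 * delta < len f.

Lemma beta_ge0 : 0 <= beta. Proof. exact: gromov_ge0. Qed.

Lemma hyp_pow_near n : len f - beta - delta <= (aS (f ^+ n.+1)%g o | aS f o).
Proof.
elim: n => [|n IHn]; first by rewrite expg1 gromov_pp; have := beta_ge0; dlra.
rewrite expgS (actM aS); have := gromov_act f (aS (f ^+ n.+1)%g o).
have := f_hyp; have := IHn; rewrite (gromov_sym o (aS (f ^+ n.+1)%g o) (aS f o)) /beta.
by case: (gromov_or (aS f o) (aS (f ^+ n.+1)%g o) (aS f^-1%g o)); dlra.
Qed.

Lemma hyp_pow_away n : (aS (f ^+ n.+1)%g o | aS f^-1%g o) <= beta + delta.
Proof.
have := f_hyp; have := hyp_pow_near n.
rewrite (gromov_sym o (aS (f ^+ n.+1)%g o) (aS f o)) /beta.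
by case: (gromov_or (aS f o) (aS (f ^+ n.+1)%g o) (aS f^-1%g o)); dlra.
Qed.

Lemma hyp_pow_len n : n%:R * delta <= len (f ^+ n)%g.
Proof.
elim: n => [|[_|n IHn]]; first by rewrite mul0r mdist_ge0.
  by rewrite mul1r expg1; have := f_hyp; have := beta_ge0; dlra.
rewrite expgS (actM aS) -(isometry f^-1%g) (actgK aS) mdist_gromov.
have := len_inv f; have := hyp_pow_away n; have := f_hyp; have := IHn.
by rewrite -[n.+2%:R]natr1 mulrDl mul1r; dlra.
Qed.

End Hyperbolic.

Lemma hyp_opposite f m n : 2 * (aS f o | aS f^-1%g o) + 3 * delta < len f ->
  (aS (f ^+ m)%g o | aS (f^-1 ^+ n)%g o) <= (aS f o | aS f^-1%g o) + 2 * delta.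
Proof.
move=> fh; have b0 := beta_ge0 f.
have fVh : 2 * (aS f^-1%g o | aS f^-1%g^-1%g o) + 3 * delta < len f^-1%g.
  by rewrite invgK len_inv gromov_sym.
case: m => [|m].
  by rewrite expg0 (act1 aS); have := gromov_le o o (aS (f^-1 ^+ n)%g o); rewrite mdistxx; dlra.
case: n => [|n].
  rewrite expg0 (act1 aS) gromov_sym; have := gromov_le o o (aS (f ^+ m.+1)%g o).
  by rewrite mdistxx; dlra.
have := hyp_pow_away fh m; have := hyp_pow_near fVh n.
rewrite len_inv invgK (gromov_sym o (aS f^-1%g o) (aS f o)).
by case: (gromov_or (aS (f ^+ m.+1)%g o) (aS (f^-1 ^+ n.+1)%g o) (aS f^-1%g o)); dlra.
Qed.

Lemma hyp_pow_gromov f m n : 2 * (aS f o | aS f^-1%g o) + 3 * delta < len f ->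
  (m <= n)%N ->
  m%:R * delta - (aS f o | aS f^-1%g o) - 2 * delta <= (aS (f ^+ n)%g o | aS (f ^+ m)%g o).
Proof.
move=> fh /subnKC <-; rewrite expgnDr (actM aS).
have := gromov_act (f ^+ m)%g (aS (f ^+ (n - m))%g o); have := hyp_pow_len fh m.
by have := hyp_opposite (n - m) m fh; rewrite -expVgn; dlra.
Qed.

Lemma archimedean_delta M : exists n : nat, M <= n%:R * delta.
Proof.
exists (Num.bound (`|M| / delta)).
have := archi_boundP (divr_ge0 (normr_ge0 M) (ltW delta_gt0)).
by rewrite ltr_pdivrMr//; have := ler_norm M; dlra.
Qed.

Lemma hyp_pow_limit f : 2 * (aS f o | aS f^-1%g o) + 3 * delta < len f ->
  exists b, converges_to (fun n => aS (f ^+ n)%g o) b /\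
    forall M, exists N, forall n, (N <= n)%N -> near_pt b (aS (f ^+ n)%g o) M.
Proof.
move=> fh; have [b fb] : exists b, converges_to (fun n => aS (f ^+ n)%g o) b.
  apply: limit_ex; apply/(asymptoticP o) => M.
  have [N NM] := archimedean_delta (M + (aS f o | aS f^-1%g o) + 2 * delta).
  have big m n : (N <= m)%N -> (m <= n)%N -> M <= (aS (f ^+ n)%g o | aS (f ^+ m)%g o).
    move=> Nm mn; have := hyp_pow_gromov fh mn.
    have : N%:R * delta <= m%:R * delta by rewrite ler_pM2r// ler_nat.
    by dlra.
  exists N => i j Ni Nj; case: (leqP i j) => [ij|/ltnW ji]; last exact: big.
  by rewrite gromov_sym; exact: big.
exists b; split => // M.
have [N NM] := archimedean_delta (M + (aS f o | aS f^-1%g o) + 3 * delta).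
exists N => n Nn.
apply: (near_pt_le (near_pt_limit fb (fun i => hyp_pow_gromov fh (m := n) (n := i)))).
have : N%:R * delta <= n%:R * delta by rewrite ler_pM2r// ler_nat.
by dlra.
Qed.

Lemma hyp_axial H f : subgroup H -> H f -> 2 * (aS f o | aS f^-1%g o) + 3 * delta < len f ->
  exists b c, b <> c /\ axial H b c.
Proof.
move=> [H1 HM HV] Hf fh.
have fVh : 2 * (aS f^-1%g o | aS f^-1%g^-1%g o) + 3 * delta < len f^-1%g.
  by rewrite invgK len_inv gromov_sym.
have [b [fb bP]] := hyp_pow_limit fh; have [c [fc cP]] := hyp_pow_limit fVh.
exists b, c; split.
  move=> E; subst c.
  have /(asymptoticP o)/(_ ((aS f o | aS f^-1%g o) + 3 * delta)) [N NP] := reprs_asymptotic fb fc.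
  by have := NP N N (leqnn _) (leqnn _); have := hyp_opposite N N fh; dlra.
move=> M; have [N NP] := bP M; have [N' NP'] := cP M.
exists (f ^+ maxn N N')%g; split.
- by elim: (maxn N N') => [|n IHn]; rewrite ?expg0// expgS; exact: HM.
- exact: NP (leq_maxl _ _).
- by rewrite -expVgn; exact: NP' (leq_maxr _ _).
Qed.

(** * Subgroups without hyperbolic elements *)

Definition unbounded (H : set G) : Prop := forall M, exists2 g, H g & M <= len g.

(** Follow the chain [g o], [g^-1 o], [h^-1 o], [h o]. The outer links are large since [g] and [h]
    violate the criterion. If [g o] and [h o] had a small product, [k = g^-1 h] would be long and
    violate it too, which makes the middle link large. *)
Lemma nonhyp_gromov H : subgroup H ->
  (forall f, H f -> len f <= 2 * (aS f o | aS f^-1%g o) + 3 * delta) ->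
  forall g h r, H g -> H h -> r <= len g -> r <= len h -> r / 2 - 4 * delta <= (aS g o | aS h o).
Proof.
move=> [_ HM HV] nH g h r Hg Hh rg rh.
pose k := (g^-1 * h)%g.
have kk := nH k (HM _ _ (HV _ Hg) Hh).
have kV : k^-1%g = (h^-1 * g)%g by rewrite /k invgM invgK.
have lk : len k = len g + len h - 2 * (aS g o | aS h o).
  by rewrite /k (actM aS) -(isometry g) (actgKV aS) mdist_gromov (gromov_sym o (aS h o)); dlra.
have e1 := gromov_act g^-1%g (aS h o); have e2 := gromov_act h^-1%g (aS g o).
move: e1 e2; rewrite -!(actM aS) -kV -/k !invgK !len_inv (gromov_sym o (aS h o)) => e1 e2.
have gg := nH g Hg; have hh := nH h Hh.
rewrite leNgt; apply/negP => C.
move: e1; rewrite (gromov_sym o (aS k o)) => e1.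
move: hh; rewrite (gromov_sym o (aS h o)) => hh.
have c1 : r - (aS g o | aS h o) - 4 * delta <= (aS g^-1%g o | aS h^-1%g o).
  case: (gromov_or (aS g^-1%g o) (aS k o) (aS h^-1%g o)); first by dlra.
  by case: (gromov_or (aS k o) (aS k^-1%g o) (aS h^-1%g o)); dlra.
case: (gromov_or (aS g o) (aS g^-1%g o) (aS h o)); first by dlra.
by case: (gromov_or (aS g^-1%g o) (aS h^-1%g o) (aS h o)); dlra.
Qed.

(** Any sequence of elements of [H] with lengths tending to infinity converges, and by
    [nonhyp_gromov] its translates by [H] have the same limit, which is therefore fixed. *)
Lemma nonhyp_fixed H : subgroup H -> unbounded H ->
  (forall f, H f -> len f <= 2 * (aS f o | aS f^-1%g o) + 3 * delta) ->
  exists2 b, limit_set aS b & forall h, H h -> ab h b = b.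
Proof.
move=> sH uH nH; have [_ HM _] := sH; have key := nonhyp_gromov sH nH.
have /boolp.choice[g gP] : forall n : nat, exists g : G, H g /\ n%:R <= len g.
  by move=> n; have [g Hg gn] := uH n%:R; exists g.
have cvg h : H h -> asymptotic (fun n => aS h (aS (g n) o)) (fun n => aS (g n) o).
  move=> Hh; apply/(asymptoticP o) => M.
  pose N := Num.bound (2 * (`|M| + 4 * delta) + len h).
  have NP : 2 * (M + 4 * delta) + len h <= N%:R.
    have := archi_boundP (addr_ge0 (mulr_ge0 (ler0n _ 2) (addr_ge0 (normr_ge0 M)
      (mulr_ge0 (ler0n _ 4) (ltW delta_gt0)))) (mdist_ge0 (aS h o) o)).
    by rewrite -/N; have := ler_norm M; dlra.
  exists N => i j Ni Nj; rewrite -(actM aS).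
  have hi := len_mul_ge h (g i); have h0 := mdist_ge0 (aS h o) o.
  have [ni nj] := ((gP i).2, (gP j).2).
  have Ni' : N%:R <= i%:R :> R by rewrite ler_nat.
  have Nj' : N%:R <= j%:R :> R by rewrite ler_nat.
  have := key (h * g i)%g (g j) (2 * (M + 4 * delta)) (HM _ _ Hh (gP i).1) (gP j).1.
  by move=> /(_ ltac:(dlra) ltac:(dlra)); dlra.
have cvg1 : converges_at_infinity (fun n => aS (g n) o).
  have [H1 _ _] := sH; have := cvg _ H1; congr asymptotic.
  by apply/funext => n; rewrite (act1 aS).
have [b gb] := limit_ex cvg1; exists b.
  by exists o, (fun n => aS (g n) o); split => // i; exists (g i).
by move=> h /cvg; exact: (asymptotic_eq (converges_to_act h gb) gb).
Qed.

(** If a fixed point is away from [g^-1 o], then [g] pushes it close to [g o]; the other fixed point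
    is then away from [g o], so [g^-1] pushes that one close to [g^-1 o]. *)
Lemma axis_dir b c (g : G) r : far_apart b c r -> ab g b = b -> ab g c = c ->
  (near_pt b (aS g o) (len g - r - 3 * delta) /\
   near_pt c (aS g^-1%g o) (len g - r - 3 * delta)) \/
  (near_pt c (aS g o) (len g - r - 3 * delta) /\
   near_pt b (aS g^-1%g o) (len g - r - 3 * delta)) \/ len g <= 2 * r + 7 * delta.
Proof.
move=> bc gb gc.
have [lg|lg] := leP (len g) (2 * r + 7 * delta); [by right; right|].
have side d e : far_apart d e r -> ab g d = d -> ab g e = e ->
    far_pt d (aS g^-1%g o) (r + 2 * delta + delta) ->
    near_pt d (aS g o) (len g - r - 3 * delta) /\
    near_pt e (aS g^-1%g o) (len g - r - 3 * delta).
  move=> de gd ge /near_pt_inv; rewrite gd => dg.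
  have dg' : near_pt d (aS g o) (len g - r - 3 * delta) by apply: near_pt_le dg _; dlra.
  split => //; have := near_far_apart dg' de.
  move=> /(_ ltac:(dlra)); rewrite -{1}(invgK g) => /near_pt_inv.
  by rewrite (fixedV (a := ab) ge) len_inv => /near_pt_le; apply; dlra.
have [nb|/(side _ _ bc gb gc)] := near_or_far b (aS g^-1%g o) (r + 2 * delta); last by left.
right; left; apply: (side _ _ (far_apart_sym bc) gc gb).
by apply: far_pt_le (near_far_apart nb bc _) _; dlra.
Qed.

Lemma loxodromic_axial g : loxodromic aS g -> exists b c,
  [/\ b <> c, axial [set: G] b c, ab g b = b & ab g c = c].
Proof.
move=> [/(_ o) ub [b [c [bc fixE]]]].
have fix_cyc d h : [set b; c] d -> cyclic_subgroup g h -> ab h d = d.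
  by rewrite -fixE => dP; exact: dP.
have [r far] := far_apart_ex bc.
have n1 := ler_norm r; have m1 := normr_ge0 r.
have gg : cyclic_subgroup g g by exists 1%N; left; rewrite expg1.
exists b, c; split => //; [|by apply: fix_cyc; [left|]|by apply: fix_cyc; [right|]].
move=> M; have n2 := ler_norm M; have m2 := normr_ge0 M.
have [h hg hM] : exists2 h, cyclic_subgroup g h & `|M| + 2 * `|r| + 8 * delta <= len h.
  apply: contrapT => C; apply: ub.
  exists (2 * (`|M| + 2 * `|r| + 8 * delta)) => _ _ [h hg <-] [k kg <-].
  have lt k' : cyclic_subgroup g k' -> len k' < `|M| + 2 * `|r| + 8 * delta.
    by move=> k'g; rewrite ltNge; apply/negP => ?; apply: C; exists k'.
  have := lt _ hg; have := lt _ kg; have := metric_triangle (aS h o) o (aS k o).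
  by rewrite (metric_sym o (aS k o)); dlra.
have hb : ab h b = b by apply: fix_cyc => //; left.
have hc : ab h c = c by apply: fix_cyc => //; right.
have [[h1 h2]|[[h1 h2]|]] := axis_dir far hb hc; last by dlra.
  by exists h; split => //; [apply: near_pt_le h1 _|apply: near_pt_le h2 _]; dlra.
by exists h^-1%g; split; rewrite ?invgK//; [apply: near_pt_le h2 _|apply: near_pt_le h1 _]; dlra.
Qed.

(** * Criteria for smallness *)

(** As [C'] is not small, every long enough [g] has a point [u] of [C'] close to [g o]. Take such a
    [g] away from [C]: elements of [H] approaching [u] are close to [g o] as well, hence away from
    [C]. *)
Lemma small_transfer H C C' : (forall b, C' b -> orbit_limit H b) ->
  small [set: G] C -> ~ small [set: G] C' -> small H C.
Proof.
move=> C'H [r Cr] nC'.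
have [M0 M0P] : exists M0, forall g : G, M0 <= len g ->
    exists2 b, C' b & near_pt b (aS g o) (r + 4 * delta).
  apply: contrapT => /forallNP C0; apply: nC'; exists (r + 4 * delta + delta) => M.
  have /existsNP[g /not_implyP[gM gC]] := C0 M; exists g; split => // b C'b.
  by have [nb|//] := near_or_far b (aS g o) (r + 4 * delta); case: gC; exists b.
have [g [_ gM0 gC]] := Cr M0; have [u C'u ug] := M0P g gM0.
have n1 := ler_norm r; have m1 := normr_ge0 r.
exists (r + delta) => M; have n2 := ler_norm M; have m2 := normr_ge0 M.
have [h Hh uh] := C'H u C'u (`|M| + `|r| + 5 * delta).
exists h; split => //; first by have := near_pt_len uh; dlra.
have hg : r + 3 * delta <= (aS h o | aS g o).
  have [x xu] := repr_ex u; have [N _ /(_ N (leqnn N)) [/= xh xg]] := filterI (uh _ xu) (ug _ xu).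
  rewrite (gromov_sym o (x N)) in xh.
  by case: (gromov_or (aS h o) (x N) (aS g o)); dlra.
move=> b Cb x xb; apply: filterS (gC _ Cb _ xb) => i xg.
by case: (gromov_or (x i) (aS h o) (aS g o)); dlra.
Qed.

(** Each boundary point is close to at most one of three diverging orbit points, so one of the three
    is away from both [b] and [c]. *)
Lemma pair_small H b c : directions H 3%N -> small H [set b; c].
Proof.
move=> [r rP]; exists (r + 2 * delta + delta) => M; have [t [Ht tM tr]] := rP M.
have one e : exists k : 'I_3, forall i, i != k -> far_pt e (aS (t i) o) (r + 2 * delta + delta).
  have [[k ek]|C] := pselect (exists k, near_pt e (aS (t k) o) (r + 2 * delta)).
    exists k => i ik; have [ei|//] := near_or_far e (aS (t i) o) (r + 2 * delta).
    have [x xe] := repr_ex e; have [N _ /(_ N (leqnn N)) [/= xi xk]] := filterI (ei _ xe) (ek _ xe).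
    rewrite (gromov_sym o (x N)) in xi; have := tr _ _ ik.
    by case: (gromov_or (aS (t i) o) (x N) (aS (t k) o)); dlra.
  exists ord0 => i _; have [ei|//] := near_or_far e (aS (t i) o) (r + 2 * delta).
  by case: C; exists i.
have [kb bP] := one b; have [kc cP] := one c.
have [i ib ic] : exists2 i : 'I_3, i != kb & i != kc.
  have : (#|[set kb; kc]%SET| < 3)%N by rewrite cards2; case: (kb != kc).
  rewrite -[X in (_ < X)%N]card_ord -cardsT => lt.
  have /existsP[i] : [exists i, i \notin [set kb; kc]%SET].
    apply: contraTT lt => /existsPn C; rewrite -leqNgt.
    apply/subset_leq_card/fintype.subsetP => i _.
    by have := C i; rewrite negbK.
  by rewrite !inE negb_or => /andP[ib ic]; exists i.
by exists (t i); split => // _ [->|->]; [exact: bP|exact: cP].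
Qed.

(** The elements witnessing smallness are those of an orbit sequence converging to [eta]. *)
Lemma ball_small C (eta : boundary S) (r : R) : limit_set aS eta ->
  (forall b, C b -> ~ (r%:E < boundary_product o eta b)%E) -> small [set: G] C.
Proof.
move=> [s [x [xeta xs]]] Cr.
have /boolp.choice[g gx] : forall n, exists g : G, aS g s = x n.
  by move=> n; have [g _ gs] := xs n; exists g.
have xx := reprs_asymptotic xeta xeta.
(* If all late products exceeded [r + 3 * delta], passing to arbitrary representatives would cost
   [2 * delta], and the infimum of the lower limits would be at least [r + delta]. *)
have nfar u y : C u -> converges_to y u -> forall N, exists k l,
    [/\ (N <= k)%N, (N <= l)%N & (x k | y l) < r + 3 * delta].
  move=> Cu yu N; apply: contrapT => D; apply: (Cr u Cu).
  apply: (@lt_le_trans _ _ (r + delta)%:E); first by rewrite lte_fin; dlra.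
  apply: le_ereal_inf_tmp => _ [x' [y' [x'eta y'u ->]]].
  have /(asymptoticP o)/(_ (r + 3 * delta)) [N1 N1P] := reprs_asymptotic x'eta xeta.
  have /(asymptoticP o)/(_ (r + 3 * delta)) [N2 N2P] := reprs_asymptotic yu y'u.
  pose M := maxn N (maxn N1 N2).
  have [NM N1M N2M] : [/\ (N <= M)%N, (N1 <= M)%N & (N2 <= M)%N].
    by rewrite /M !leq_max !leqnn !orbT.
  rewrite limf_einfE; apply: (@le_trans _ _ (ereal_inf
    [set (x' ij.1 | y' ij.2)%:E | ij in [set ij | (M <= ij.1)%N /\ (M <= ij.2)%N]])); last first.
    apply: ereal_sup_ubound; exists [set ij | (M <= ij.1)%N /\ (M <= ij.2)%N] => //.
    by exists ([set i | (M <= i)%N], [set i | (M <= i)%N]) => //=; split; exists M.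
  apply: le_ereal_inf_tmp => _ [[i j] /= [Mi Mj] <-]; rewrite lee_fin.
  have h1 := N1P i M (leq_trans N1M Mi) N1M; have h2 := N2P M j N2M (leq_trans N2M Mj).
  have h3 : r + 3 * delta <= (x M | y M).
    by rewrite leNgt; apply/negP => h3; apply: D; exists M, M.
  by case: (gromov_or (x' i) (x M) (y' j)); case: (gromov_or (x M) (y M) (y' j)); dlra.
(* The sequence lies in the orbit of [s]; replacing [s] by the base point [o] costs [mdist s o]. *)
exists (r + 5 * delta + mdist s o) => M.
have /(asymptoticP o)/(_ (`|M| + `|r| + mdist s o + 10 * delta)) [N NP] := xx.
have n1 := ler_norm M; have m1 := normr_ge0 M; have n2 := ler_norm r; have m2 := normr_ge0 r.
have so := mdist_ge0 s o.
exists (g N); split => //.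
  have := NP N N (leqnn N) (leqnn N); rewrite gromov_pp -gx.
  by have := metric_triangle (aS (g N) s) (aS (g N) o) o; rewrite isometry; dlra.
move=> u Cu y yu.
have /(asymptoticP o)/(_ (`|r| + 10 * delta)) [N1 N1P] := reprs_asymptotic yu yu.
exists N1 => // j /= N1j.
have [k [l [kN lN xy]]] := nfar u y Cu yu (maxn N N1).
move: kN lN; rewrite !geq_max => /andP[Nk N1k] /andP[Nl N1l].
have h1 := NP k N Nk (leqnn N); have h2 := N1P j l N1j N1l.
have h3 := gromov_lip o (aS (g N) o) (x N) (y j).
rewrite -{1}gx isometry (metric_sym o s) in h3.
rewrite (gromov_sym o (y j)).
by case: (gromov_or (x k) (x N) (y l)); case: (gromov_or (x N) (y j) (y l)); dlra.
Qed.

Lemma small_setT H C : small H C -> small [set: G] C.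
Proof. by move=> [r Cr]; exists r => M; have [g [_ gM gC]] := Cr M; exists g. Qed.

Lemma infinite_directions H n : infinite_set (orbit_limit H) -> directions H n.
Proof.
move=> Hinf; have [b0 _] : orbit_limit H !=set0.
  by apply/set0P/eqP => E; apply: Hinf; rewrite E.
have [B BH nB] := infinite_set_fset n Hinf.
have dI : injective (fun i : 'I_n => nth b0 (finmap.enum_fset B) i).
  move=> i j /eqP; rewrite nth_uniq ?finmap.fset_uniq ?(leq_trans (ltn_ord _) nB)//.
  by move=> /eqP/val_inj.
apply: (orbit_limit_directions dI) => i.
have Bi : nth b0 (finmap.enum_fset B) i \in finmap.enum_fset B.
  by rewrite mem_nth// (leq_trans (ltn_ord i) nB).
by have := BH _ Bi.
Qed.

Lemma axial_unbounded H b c : axial H b c -> unbounded H.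
Proof.
move=> bc M; have [g [Hg /near_pt_len gM _]] := bc M; by exists g.
Qed.

Lemma double_coset_unbounded (H K : set G) g :
  (forall h, H h -> K h \/ exists k k', [/\ K k, K k' & h = (k * (g * k'))%g]) ->
  unbounded H -> unbounded K.
Proof.
move=> HK uH M; apply: contrapT => C.
have lt k : K k -> len k < M.
  by move=> Kk; rewrite ltNge; apply/negP => ?; apply: C; exists k.
have n1 := ler_norm M; have m1 := normr_ge0 M; have g0 := mdist_ge0 (aS g o) o.
have [h Hh] := uH (2 * `|M| + len g); have [/lt|[k [k' [/lt kM /lt kM' ->]]]] := HK h Hh.
  by dlra.
by have := len_mul k (g * k')%g; have := len_mul g k'; dlra.
Qed.

(** The second loxodromic element moves both ends of the first axis, which gives richness; an end of
    its own axis is a third limit point, which gives directions. *)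
Lemma general_type_rich : general_type aS ->
  rich [set: G] /\ (forall n, directions [set: G] n) /\ unbounded [set: G] /\
  exists b c, b <> c /\ axial [set: G] b c.
Proof.
move=> [_ [g [h [/loxodromic_axial[b [c [bc axg gb gc]]]
  /loxodromic_axial[b' [c' [_ axh hb' hc']]] gh]]]].
have sT : subgroup [set: G] by [].
have hmoves d : ab g d = d -> ab h d <> d.
  by move=> gd hd; have : set0 d by rewrite -gh.
split; first exact: (axial_rich sT axg bc (t := h) (t' := h) _ (hmoves _ gb) _ (hmoves _ gc)).
split; last by split; [exact: axial_unbounded axg|exists b, c].
move=> n; apply: infinite_directions.
apply: (@orbit_limit_infinite _ b c b' sT) => //.
- exact: axial_limitl axg.
- exact: (axial_limitl (axial_sym sT axg)).
- exact: axial_limitl axh.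
- by move=> E; apply: (hmoves _ gb); rewrite E.
- by move=> E; apply: (hmoves _ gc); rewrite E.
Qed.

Lemma separated_disjoint U V b : separated U V -> U b -> V b -> False.
Proof.
move=> UV Ub Vb; have [x xb] := repr_ex b.
have [N _ /(_ N (leqnn N)) /=] := UV b b b b Ub Ub Vb Vb x x x x xb xb xb xb.
by rewrite ltxx.
Qed.

Lemma separated_sub U V U' V' : U' `<=` U -> V' `<=` V -> separated U V -> separated U' V'.
Proof.
by move=> U'U V'V UV u u' v v' /U'U Uu /U'U Uu' /V'V Vv /V'V Vv'; exact: UV.
Qed.

Lemma separated_act g U V : separated U V ->
  separated [set ab g b | b in U] [set ab g b | b in V].
Proof.
move=> UV _ _ _ _ [u Uu <-] [u' Uu' <-] [v Vv <-] [v' Vv' <-] x x' y y'.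
move=> /converges_to_actV[{}x xu ->] /converges_to_actV[{}x' xu' ->].
move=> /converges_to_actV[{}y yv ->] /converges_to_actV[{}y' yv' ->].
by apply: filterS (UV _ _ _ _ Uu Uu' Vv Vv' _ _ _ _ xu xu' yv yv') => i; rewrite !isometry.
Qed.

(* The two separations compare the same two sums of opposite distances of a
   quadrilateral, in opposite directions. *)
Lemma separated_cross U1 U2 W1 W2 : separated U1 U2 -> separated W1 W2 ->
  U1 `&` W1 !=set0 -> U1 `&` W2 !=set0 -> U2 `&` W1 !=set0 -> U2 `&` W2 !=set0 -> False.
Proof.
move=> U12 W12 [u11 [a11 b11]] [u12 [a12 b12]] [u21 [a21 b21]] [u22 [a22 b22]].
have [x11 r11] := repr_ex u11; have [x12 r12] := repr_ex u12.
have [x21 r21] := repr_ex u21; have [x22 r22] := repr_ex u22.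
have [N _ /(_ N (leqnn N)) /= []] := filterI
  (U12 _ _ _ _ a11 a12 a21 a22 _ _ _ _ r11 r12 r21 r22)
  (W12 _ _ _ _ b11 b21 b12 b22 _ _ _ _ r11 r21 r12 r22).
by move=> h1 h2; have := lt_trans h1 h2; rewrite ltxx.
Qed.

(** * The action on Omega *)

Section Omega.
Context {Omega : Type}.
Variable aOmega : group_action G Omega.
Notation aO := aOmega.

Hypothesis gT : general_type aS.
Hypothesis faithX : forall g, (forall b, limit_set aS b -> ab g b = b) -> g = 1%g.
Hypothesis faithO : faithful_action aOmega.
Hypothesis trans : k_transitive 3 aOmega.
Implicit Types w v : Omega.

Lemma trans3 w1 w2 w3 v1 v2 v3 :
  w1 <> w2 -> w1 <> w3 -> w2 <> w3 -> v1 <> v2 -> v1 <> v3 -> v2 <> v3 ->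
  exists g, [/\ aO g w1 = v1, aO g w2 = v2 & aO g w3 = v3].
Proof.
move=> w12 w13 w23 v12 v13 v23.
pose f (x1 x2 x3 : Omega) (i : 'I_3) := if val i is k.+1 then (if k is 0 then x2 else x3) else x1.
have f_inj (x1 x2 x3 : Omega) : x1 <> x2 -> x1 <> x3 -> x2 <> x3 -> injective (f x1 x2 x3).
  move=> x12 x13 x23 [[|[|[|//]]] i3] [[|[|[|//]]] j3]; rewrite /f /= => E; try exact: val_inj;
  by [case: (x12)|case: (x13)|case: (x23)].
have [g gP] := trans (f_inj _ _ _ w12 w13 w23) (f_inj _ _ _ v12 v13 v23).
exists g; split; first exact: (gP ord0).
  exact: (gP (Ordinal (isT : (1 < 3)%N))).
exact: (gP (Ordinal (isT : (2 < 3)%N))).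
Qed.

(* Otherwise every element of [G] would be an involution. *)
Lemma three_points : exists w1 w2 w3, [/\ w1 <> w2, w1 <> w3 & w2 <> w3].
Proof.
have [_ [_ [_ [b [c [bc axbc]]]]]] := general_type_rich gT.
apply: contrapT => C.
have inv g : g^-1%g = g.
  apply: (mulgI g); rewrite mulgV; apply/esym/faithO => w; rewrite actM.
  apply: contrapT => ggw; apply: C; exists w, (aO g w), (aO g (aO g w)); split.
  - by move=> E; apply: ggw; rewrite -!E.
  - exact/nesym.
  - by move=> /(@act_inj _ _ aO) E; apply: ggw; rewrite -!E.
have [r far] := far_apart_ex bc; have [g [_ bg cg]] := axbc (r + 2 * delta).
by rewrite inv in cg; have := near_near_neq bg cg far; dlra.
Qed.

(** Completes pairs and single points to triples, so that 3-transitivity yields 2-transitivity and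
    transitivity. *)
Lemma third_point w v : exists u, u <> w /\ u <> v.
Proof.
have [w1 [w2 [w3 [w12 w13 w23]]]] := three_points.
have [E1|] := pselect (w1 = w \/ w1 = v); last by move=> /not_orP; exists w1.
have [E2|] := pselect (w2 = w \/ w2 = v); last by move=> /not_orP; exists w2.
exists w3; split => E; subst w3; case: E1 => E1; case: E2 => E2; subst => //.
Qed.

Lemma trans2 w1 w2 v1 v2 : w1 <> w2 -> v1 <> v2 ->
  exists g, aO g w1 = v1 /\ aO g w2 = v2.
Proof.
move=> w12 v12; have [w3 [w31 w32]] := third_point w1 w2.
have [v3 [v31 v32]] := third_point v1 v2.
have [g [g1 g2 _]] := trans3 w12 (nesym w31) (nesym w32) v12 (nesym v31) (nesym v32).
by exists g.
Qed.

Lemma trans1 w v : exists g, aO g w = v.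
Proof.
have [w' [w'w _]] := third_point w w; have [v' [v'v _]] := third_point v v.
by have [g [gw _]] := trans2 (nesym w'w) (nesym v'v); exists g.
Qed.

Definition stab w : set G := [set g | aO g w = w].

Lemma stab_subgroup w : subgroup (stab w).
Proof.
split=> [|g h gw hw|g gw]; rewrite /stab /=; first exact: act1.
  by rewrite actM hw.
exact: fixedV.
Qed.

Lemma stab_unbounded w : unbounded (stab w).
Proof.
have [_ [_ [uG _]]] := general_type_rich gT.
have [v [vw _]] := third_point w w; have [g gw] := trans1 w v.
apply: (@double_coset_unbounded [set: G] _ g _ uG) => h _.
have [hw|hw] := pselect (aO h w = w); [by left|right].
(* [k] fixes [w] and sends [v = g w] to [h w], so the remaining factor [g^-1 k^-1 h] also fixes
   [w]. *)
have [k [kw kv]] := trans2 (nesym vw) (nesym hw).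
exists k, (g^-1 * (k^-1 * h))%g; split => //; last by rewrite mulVKg mulVKg.
by rewrite /stab /= !actM -kv actgK -gw actgK.
Qed.

Lemma stab2_unbounded w v : w <> v -> unbounded (stab w `&` stab v).
Proof.
move=> wv; have [u [uw uv]] := third_point w v.
have [g [gw gv]] := trans2 wv (nesym uw).
apply: (@double_coset_unbounded (stab w) _ g _ (stab_unbounded w)) => h hw.
have [hv|hv] := pselect (aO h v = v); [by left|right].
have whv : w <> aO h v by move=> E; apply: wv; apply: (act_inj (a := aO) (g := h)); rewrite hw.
have [k [kw kv ku]] := trans3 wv (nesym uw) (nesym uv) wv whv (nesym hv).
exists k, (g^-1 * (k^-1 * h))%g; split => //; last by rewrite mulVKg mulVKg.
split; rewrite /stab /= !actM; first by rewrite hw (fixedV kw) (fixedV gw).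
by rewrite -ku actgK -gv actgK.
Qed.

(** Two contractions of [C] into diverging directions give [g] with [g C] uniformly far from [C].
    The stabilizer of [w] and [g w] preserves both sets, so [bridge] bounds it, against
    [stab2_unbounded]. *)
Lemma no_small_invariant w C b c : small [set: G] C ->
  (forall h b, stab w h -> C b -> C (ab h b)) -> C b -> C c -> b <> c -> False.
Proof.
move=> sC iC Cb Cc bc; have [rT [tP' _]] := general_type_rich gT.
have sT : subgroup [set: G] by [].
have [r rP] := small_contract sT rT; have [t tP] := tP' 2%N.
have [s [_ sM st]] := tP (`|r| + `|t| + 3 * delta).
have n1 := ler_norm r; have m1 := normr_ge0 r; have n2 := ler_norm t; have m2 := normr_ge0 t.
have [h0 _ h0P] := rP C sC (s ord0) I; have [h1 _ h1P] := rP C sC (s ord_max) I.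
have [g [q0 far]] : exists g (q0 : R),
    forall u v : boundary S, C u -> C v -> far_apart u (ab g v) q0.
  exists (h0^-1 * h1)%g, (t + delta + delta + len h0^-1%g) => u v Cu Cv.
  rewrite -[u](actgK ab h0) (actM ab); apply: far_apart_act.
  apply: (near_near_apart (h0P _ Cu) (h1P _ Cv) (st _ _ _)) => //.
    by have := sM ord0; dlra.
  by have := sM ord_max; dlra.
have gw : w <> aO g w.
  move=> /esym gw; have gb := iC g b gw Cb.
  by have := far_apart_neq (far _ _ gb Cb).
have [q1 q1P] := far_apart_ex bc.
have [q2 q2P] : exists q : R, far_apart (ab g b) (ab g c) q.
  by apply: far_apart_ex => /(@act_inj _ _ ab).
have n3 := ler_norm q1; have m3 := normr_ge0 q1; have n4 := ler_norm q2; have m4 := normr_ge0 q2.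
have bd := @bridge (stab w `&` stab (aO g w)) C [set ab g v | v in C] b c (ab g b) (ab g c)
  _ (`|q1| + `|q2|) _ _ _ Cb Cc _ _ _ _.
have [k Kk] := stab2_unbounded gw
  (`|q1| + `|q2| + q0 + 2 * delta + 1).
rewrite leNgt; move=> /negP; apply; apply: le_lt_trans (bd _ _ _ _ _ _ _ _ _ Kk) _.
- by move=> k' b' [k'w _]; apply: iC; exact: (fixedV k'w).
- move=> k' _ [k'w k'gw] [v Cv <-]; exists (ab (g^-1 * (k'^-1 * g))%g v).
    by apply: iC => //; rewrite /stab /= !actM (fixedV k'gw) actgK.
  by rewrite -(actM ab) mulVKg (actM ab).
- by move=> b' _ Cb' [v Cv <-]; exact: far.
- by exists b.
- by exists c.
- by apply: far_apart_le q1P _; dlra.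
- by apply: far_apart_le q2P _; dlra.
- by dlra.
Qed.

(** * Supports *)

(** Restricted to the limit set, where the action is assumed faithful. *)
Definition support g : set (boundary S) := [set b | limit_set aS b /\ ab g b <> b].

Definition small_elt g : Prop := small [set: G] (support g).

Lemma support_neq0 g : g <> 1%g -> support g !=set0.
Proof.
move=> g1; apply: contrapT => C; apply/g1/faithX => b Xb; apply: contrapT => gb.
by apply: C; exists b.
Qed.

Lemma limit_set_act g b : limit_set aS b -> limit_set aS (ab g b).
Proof. exact: limit_set_invariant. Qed.

Lemma support_act g b : support g b -> support g (ab g b).
Proof. by move=> [Xb gb]; split; [exact: limit_set_act|move=> /(@act_inj _ _ ab)]. Qed.

Lemma support_conj h g : support (h * (g * h^-1))%g = [set ab h b | b in support g].
Proof.
apply/seteqP; split => [b [Xb hb]|_ [b [Xb gb] <-]].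
  exists (ab h^-1%g b); last exact: (actgKV ab).
  split; first exact: limit_set_act.
  by move=> E; apply: hb; rewrite !(actM ab) E (actgKV ab).
split; first exact: limit_set_act.
by rewrite -(actM ab) -!mulgA mulVg mulg1 (actM ab) => /(@act_inj _ _ ab).
Qed.

Lemma supportV g : support g^-1%g = support g.
Proof.
apply/seteqP; split=> b [Xb gb]; split => // E; apply: gb; first exact: (fixedV E).
by have := fixedV E; rewrite invgK.
Qed.

Lemma supportM g h : support (g * h)%g `<=` support g `|` support h.
Proof.
move=> b [Xb ghb]; have [hb|hb] := pselect (ab h b = b); last by right.
by left; split => // gb; apply: ghb; rewrite (actM ab) hb.
Qed.

Lemma act_ext g h : (forall b, limit_set aS b -> ab g b = ab h b) -> g = h.
Proof.
move=> gh; apply: (mulgI h^-1%g); rewrite mulVg; apply: faithX => b Xb.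
by rewrite (actM ab) gh// (actgK ab).
Qed.

Lemma small_elt_conj h g : small_elt g -> small_elt (h * (g * h^-1))%g.
Proof. by rewrite /small_elt support_conj; exact: small_act. Qed.

Lemma conj_neq1 h g : g <> 1%g -> (h * (g * h^-1))%g <> 1%g.
Proof.
move=> g1 E; apply: g1; apply: (mulgI h); apply: (mulIg h^-1%g).
by rewrite -mulgA E mulg1 mulgV.
Qed.

Lemma disjoint_commute g h :
  (forall b, support g b -> support h b -> False) -> (g * h = h * g)%g.
Proof.
move=> dis.
apply: act_ext => b Xb; rewrite !(actM ab).
have fixes k k' c : limit_set aS c -> (forall e, support k e -> support k' e -> False) ->
    support k c -> ab k' c = c.
  by move=> Xc kk' kc; apply: contrapT => k'c; exact: (kk' c kc).
have [gb|/(conj Xb) gb] := pselect (ab g b = b); last first.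
  rewrite (fixes g h b)// (fixes g h (ab g b))//; first exact: limit_set_act.
  exact: support_act.
have [hb|/(conj Xb) hb] := pselect (ab h b = b); first by rewrite hb gb hb.
rewrite gb (fixes h g (ab h b))//; first exact: limit_set_act.
  by move=> e he ge; exact: (dis e).
exact: support_act.
Qed.

(** By [disjoint_commute], elements that do not commute have intersecting supports. A conjugate of
    the pair [a1, a2], none of whose members commutes with [a1] or [a2], therefore violates
    [separated_cross]. *)
Lemma no_common_fixed_moved a1 a2 w v : separated (support a1) (support a2) ->
  aO a1 w = w -> aO a2 w = w -> aO a1 v <> v -> aO a2 v <> v -> False.
Proof.
move=> a12 a1w a2w a1v a2v; have com := disjoint_commute (fun b => @separated_disjoint _ _ b a12).
have moved g u u' a : aO g w = u -> aO g v = u' -> aO a v <> v ->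
    aO (g * (a * g^-1))%g u' <> u'.
  by move=> gw gv av; rewrite -gv !actM actgK => /(@act_inj _ _ aO).
have fixed g u a : aO g w = u -> aO a w = w -> aO (g * (a * g^-1))%g u = u.
  by move=> gw aw; rewrite -gw !actM actgK aw.
have wv : w <> v by move=> E; apply: a1v; rewrite -E.
(* [g] conjugates [a1] and [a2] to elements fixing [v] and moving both
   [a1 v] and [a2 v], so none of them commutes with [a1] or [a2]. *)
have [g [gw gp gq]] : exists g, [/\ aO g w = v,
    forall a, aO a v <> v -> aO a (aO a1 v) <> aO a1 v ->
      aO (g * (a * g^-1))%g (aO a1 v) <> aO a1 v &
    forall a, aO a v <> v -> aO a (aO a1 v) <> aO a1 v ->
      aO (g * (a * g^-1))%g (aO a2 v) <> aO a2 v].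
  have wa1v : w <> aO a1 v by rewrite -{1}a1w => /(@act_inj _ _ aO).
  have [E|ne] := pselect (aO a1 v = aO a2 v).
    have [g [gw gv]] := trans2 wv (nesym a1v).
    by exists g; split => // a av _; rewrite -?E; exact: (moved g _ _ a gw gv av).
  have [g [gw gv gv']] := trans3 wv wa1v (nesym a1v) (nesym a1v) (nesym a2v) ne.
  exists g; split => // a av av'; first exact: (moved g _ _ a gw gv av).
  by rewrite -gv' !actM actgK => /(@act_inj _ _ aO).
have mv1 : aO a1 (aO a1 v) <> aO a1 v by move=> /(@act_inj _ _ aO).
(* Since [a1] and [a2] commute, [a2 a1 v = a1 a2 v], which differs from [a1 v]. *)
have mv2 : aO a2 (aO a1 v) <> aO a1 v by rewrite -actM -com actM => /(@act_inj _ _ aO).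
have meets (a c : G) : aO a w = w -> aO a v <> v -> aO a (aO a1 v) <> aO a1 v ->
    aO (g * (a * g^-1))%g (aO c v) <> aO c v ->
    [set ab g b | b in support a] `&` support c !=set0.
  move=> aw av av' gac; apply: contrapT => C; apply: gac.
  suff co : (g * (a * g^-1) * c = c * (g * (a * g^-1)))%g.
    by rewrite -actM co actM (fixed _ _ _ gw aw).
  apply: disjoint_commute => b; rewrite support_conj => gab cb.
  by apply: C; exists b.
have s12 := separated_act (g := g) a12.
apply: (separated_cross s12 a12); apply: meets => //; by [exact: gp|exact: gq].
Qed.

(** * The dichotomy for point stabilizers *)

(** The conclusion of [placement] for the stabilizer of [w], but with smallness relative to the
    whole of [G]; [small_transfer] bridges the difference. *)
Definition placeable w : Prop := forall n, exists N : 'I_n -> set (boundary S),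
  [/\ forall i j, i != j -> separated (N i) (N j),
      forall i C, small [set: G] C -> exists2 h, stab w h & forall b, C b -> N i (ab h b) &
      forall i, small [set: G] (~` N i)].

Lemma stab_fixed_or_placeable w :
  (exists2 b, limit_set aS b & forall h, stab w h -> ab h b = b) \/ placeable w.
Proof.
have [|nfix] := pselect (exists2 b, limit_set aS b & forall h, stab w h -> ab h b = b).
  by left.
right; have sH := stab_subgroup w; have [rT [dT _]] := general_type_rich gT.
have moves b : limit_set aS b -> exists2 h, stab w h & ab h b <> b.
  move=> Xb; apply: contrapT => C; apply: nfix; exists b => // h hw.
  by apply: contrapT => hb; apply: C; exists h.
have [f fw f_hyp] : exists2 f, stab w f & 2 * (aS f o | aS f^-1%g o) + 3 * delta < len f.
  apply: contrapT => C; apply: nfix; apply: (nonhyp_fixed sH (stab_unbounded w)) => f fw.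
  by rewrite leNgt; apply/negP => ?; apply: C; exists f.
have [b [c [bc axbc]]] := hyp_axial sH fw f_hyp.
have Hb := axial_limitl axbc; have Hc := axial_limitl (axial_sym sH axbc).
have [t tw tb] := moves b (orbit_limit_limit_set Hb).
have [t' t'w t'c] := moves c (orbit_limit_limit_set Hc).
have rH := axial_rich sH axbc bc tw tb t'w t'c.
(* The smallest invariant set containing both ends of the axis. It consists of limit points of the
   stabilizer and is not small, as [small_transfer] requires. *)
pose C' := [set e | exists2 h, stab w h & e = ab h b \/ e = ab h c].
have [H1 HM _] := sH.
have C'b : C' b by exists 1%g => //; left; rewrite (act1 ab).
have C'c : C' c by exists 1%g => //; right; rewrite (act1 ab).
have C'H e : C' e -> orbit_limit (stab w) e.
  by move=> [h hw [->|->]]; exact: orbit_limit_act.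
have nC' : ~ small [set: G] C'.
  move=> sC'; apply: (no_small_invariant (w := w) sC' _ C'b C'c bc).
  move=> h _ hw [k kw [->|->]]; exists (h * k)%g; rewrite ?(actM ab);
    by [exact: HM|left|right].
have transfer C : small [set: G] C -> small (stab w) C.
  by move=> sC; exact: small_transfer C'H sC nC'.
(* A third limit point exists because a subset of the pair [b, c] would be small. *)
have [e [C'e be ce]] : exists e, [/\ C' e, b <> e & c <> e].
  apply: contrapT => D; apply: nC'; apply: small_sub (pair_small b c (dT 3%N)) => e C'e.
  have [eb|eb] := pselect (e = b); first by left.
  have [ec|ec] := pselect (e = c); first by right.
  by case: D; exists e; split => //; exact: nesym.
have dH n : directions (stab w) n.
  by apply/infinite_directions/(orbit_limit_infinite sH Hb Hc (C'H _ C'e)).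
move=> n; have [N [Nsep Nin Nout]] := placement sH rH (dH n).
exists N; split => [//|i C sC|i]; last exact: small_setT (Nout i).
by apply: Nin; exact: transfer.
Qed.

(** On [N j] only the factor [e j] acts. Since [N j] need not be invariant, [e j b] is required to
    stay in it, so that the other factors fix it too. *)
Lemma support_prod (I : eqType) (e : I -> G) (s : seq I) (N : I -> set (boundary S)) j :
  (forall i, i \in s -> support (e i) `<=` N i) ->
  (forall i b, i \in s -> i != j -> N i b -> N j b -> False) -> uniq s ->
  forall b, limit_set aS b -> N j b -> N j (ab (e j) b) ->
  ab (foldr (fun i g => (e i * g)%g) 1%g s) b = if j \in s then ab (e j) b else b.
Proof.
move=> eN dis; have fix1 i b : i \in s -> i != j -> limit_set aS b -> N j b -> ab (e i) b = b.
  move=> si ij Xb Nb; apply: contrapT => eb.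
  by apply: (dis i b si ij _ Nb); apply: eN => //; split.
elim: s eN dis fix1 => [|i s IHs] eN dis fix1; first by move=> *; exact: (act1 ab).
rewrite cons_uniq => /andP[si us] b Xb Nb Neb.
rewrite -[foldr _ _ (i :: s)]/(e i * foldr (fun i g => (e i * g)%g) 1%g s)%g (actM ab).
have sub k : k \in s -> k \in i :: s by move=> ks; rewrite inE ks orbT.
rewrite IHs //; last first.
- by move=> k c /sub; exact: fix1.
- by move=> k c /sub; exact: dis.
- by move=> k /sub; exact: eN.
rewrite inE; have [ji|ji] := eqVneq j i; first by subst i; rewrite (negPf si).
rewrite orFb; case: ifP => _; apply: fix1; rewrite ?mem_head// 1?eq_sym//.
exact: limit_set_act.
Qed.

Lemma support_disjoint_prod (I : eqType) (e : I -> G) (s : seq I) (N : I -> set (boundary S)) :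
  (forall i, e i <> 1%g) -> (forall i, support (e i) `<=` N i) ->
  (forall i j b, i != j -> N i b -> N j b -> False) -> uniq s ->
  forall j, if j \in s then support (foldr (fun i g => (e i * g)%g) 1%g s) `&` N j !=set0
    else support (foldr (fun i g => (e i * g)%g) 1%g s) `&` N j = set0.
Proof.
move=> e1 eN dis us j.
have prodE b := support_prod (j := j) (fun i _ => eN i) (fun i b _ => dis i j b) us (b := b).
case: ifP => js.
  have [b bj] := support_neq0 (e1 j); have Nb := eN j b bj.
  have Neb := eN j _ (support_act bj).
  by exists b; split => //; split; [exact: bj.1|rewrite prodE ?js//; [exact: bj.2|exact: bj.1]].
rewrite -subset0 => b [[Xb gb] Nb]; apply: gb.
have [eb|eb] := pselect (ab (e j) b = b); first by rewrite prodE ?js// eb.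
rewrite prodE ?js//; apply: eN; apply: support_act; by split.
Qed.

(** * The two contradictions *)

(** By [fix_le], each of the two elements moving [w] fixes the moved points of all but at most one
    of the three elements fixing [w]. So some [d i] with [i < 3] suits both, and a point it moves is
    fixed by two separated elements that both move [w]. *)
Lemma small_fixed_contra w a v : placeable w -> small_elt a -> a <> 1%g -> aO a v = v -> False.
Proof.
move=> pw sa a1 av.
have [u uv] := trans1 v w.
pose a' := (u * (a * u^-1))%g.
have a'w : aO a' w = w by rewrite /a' -uv !actM actgK av.
have sa' : small_elt a' by exact: small_elt_conj.
have a'1 : a' <> 1%g by exact: conj_neq1.
clearbody a'.
have [k kw] : exists k, aO (k * (a' * k^-1))%g w <> w.
  apply: contrapT => C; apply/a'1/faithO => x; have [k <-] := trans1 w x.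
  apply: contrapT => D; apply: C; exists k^-1%g => E; apply: D.
  move: E; rewrite invgK !actM => /(congr1 (aO k)).
  by rewrite actgKV.
pose c := (k * (a' * k^-1))%g.
have sc : small_elt c by exact: small_elt_conj.
have ck : aO c (aO k w) = aO k w by rewrite /c !actM actgK a'w.
have cw : aO c w <> w by [].
clearbody c.
have [N [Nsep Nin _]] := pw 5%N.
have /boolp.choice[h hP] : forall i : 'I_5, exists h : G,
    stab w h /\ forall b, support (if (i < 3)%N then a' else c) b -> N i (ab h b).
  move=> i; have [h hw hN] := Nin i (support (if (i < 3)%N then a' else c)) ltac:(by case: ifP).
  by exists h.
pose d i := (h i * ((if (i < 3)%N then a' else c) * (h i)^-1))%g.
have dsep i j : i != j -> separated (support (d i)) (support (d j)).
  move=> ij; apply: separated_sub (Nsep i j ij); rewrite support_conj => _ [b bs <-].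
    exact: (hP i).2.
  exact: (hP j).2.
have dw (i : 'I_5) : (i < 3)%N -> aO (d i) w = w.
  by move=> i3; rewrite /d i3 !actM (fixedV (hP i).1) a'w (hP i).1.
have d1 (i : 'I_5) : (i < 3)%N -> exists x : Omega, aO (d i) x <> x.
  move=> i3; apply: contrapT => C; have : d i <> 1%g by rewrite /d i3; exact: conj_neq1.
  by apply; apply: faithO => x; apply: contrapT => D; apply: C; exists x.
have dm (i : 'I_5) : (3 <= i)%N -> aO (d i) w <> w.
  move=> i3; rewrite /d ltnNge i3 !actM (fixedV (hP i).1) => E; apply: cw.
  by apply: (@act_inj _ _ aO (h i)); rewrite E; exact/esym/(hP i).1.
have df (i : 'I_5) : (3 <= i)%N -> exists x : Omega, aO (d i) x = x.
  move=> i3; exists (aO (h i) (aO k w)).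
  by rewrite /d ltnNge i3 !actM actgK ck.
(* The [d i] fixing [w] have disjoint supports in [Omega], the [d i] moving
   [w] have disjoint fixed sets. *)
have fix_le (j : 'I_5) : (3 <= j)%N -> forall i i' : 'I_5, (i < 3)%N -> (i' < 3)%N -> i != i' ->
    (forall x : Omega, aO (d i) x <> x -> aO (d j) x = x) \/
    (forall x : Omega, aO (d i') x <> x -> aO (d j) x = x).
  move=> j3 i i' i3 i'3 ii'.
  have [Pi|/existsNP[y /not_implyP[iy jy]]] 
    := pselect (forall x : Omega, aO (d i) x <> x -> aO (d j) x = x); first by left.
  right=> y' i'y'; apply: contrapT => jy'.
  have ij : i != j by apply: contraTneq i3 => ->; rewrite -leqNgt.
  have i'j : i' != j by apply: contraTneq i'3 => ->; rewrite -leqNgt.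
  (* Compare at a fixed point [x] of [d j]. If [d i] or [d i'] fixes [x], it shares with [d j] a
     fixed point and a moved point; otherwise [d i] and [d i'] both fix [w] and both move [x]. *)
  have [x jx] := df j j3.
  have [ix|ix] := pselect (aO (d i) x = x).
    exact: (no_common_fixed_moved (dsep i j ij) ix jx iy jy).
  have [i'x|i'x] := pselect (aO (d i') x = x).
    exact: (no_common_fixed_moved (dsep i' j i'j) i'x jx i'y' jy').
  exact: (no_common_fixed_moved (dsep i i' ii') (dw i i3) (dw i' i'3) ix i'x).
have I0 : (0 < 5)%N by []. have I1 : (1 < 5)%N by []. have I2 : (2 < 5)%N by [].
have I3 : (3 < 5)%N by []. have I4 : (4 < 5)%N by [].
pose i0 := Ordinal I0; pose i1 := Ordinal I1; pose i2 := Ordinal I2.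
pose j3 := Ordinal I3; pose j4 := Ordinal I4.
have both (i : 'I_5) : (i < 3)%N -> (forall x : Omega, aO (d i) x <> x -> aO (d j3) x = x) ->
    (forall x : Omega, aO (d i) x <> x -> aO (d j4) x = x) -> False.
  move=> i3 P3 P4; have [x ix] := d1 i i3.
  exact: (no_common_fixed_moved (dsep j3 j4 isT) (P3 x ix) (P4 x ix) (dm j3 isT) (dm j4 isT)).
have A (i i' : 'I_5) := fix_le j3 isT i i'; have B (i i' : 'I_5) := fix_le j4 isT i i'.
have [p0|p1] := A i0 i1 isT isT isT; have [q|q] := B i0 i1 isT isT isT.
- exact: both i0 isT p0 q.
- have [p|p] := A i1 i2 isT isT isT; first exact: (both i1 isT p q).
  have [q'|q'] := B i0 i2 isT isT isT; first exact: (both i0 isT p0 q').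
  exact: (both i2 isT p q').
- have [p|p] := A i0 i2 isT isT isT; first exact: (both i0 isT p q).
  have [q'|q'] := B i1 i2 isT isT isT; first exact: (both i1 isT p1 q').
  exact: (both i2 isT p q').
- exact: both i1 isT p1 q.
Qed.

(** If [g (e i) g^-1] misses a region that [bb] misses, the two agree at [w], hence are equal, and
    the conjugate meets every region met by [bb]. So it meets all regions on one side of [s1], or of
    [s2]. *)
Lemma small_free_contra w a : placeable w -> small_elt a -> a <> 1%g ->
  (forall g v, small_elt g -> aO g v = v -> g = 1%g) -> False.
Proof.
move=> pw sa a1 free; have [N [Nsep Nin Nout]] := pw 8%N.
have /boolp.choice[h hP] : forall i : 'I_8, exists h : G,
    forall b, support a b -> N i (ab h b).
  by move=> i; have [h _ hN] := Nin i _ sa; exists h.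
pose e i := (h i * (a * (h i)^-1))%g.
have e1 i : e i <> 1%g by exact: conj_neq1.
have eN i : support (e i) `<=` N i.
  by rewrite support_conj => _ [b bs <-]; exact: hP.
clearbody e.
have dis i j b : i != j -> N i b -> N j b -> False.
  by move=> ij; exact: separated_disjoint (Nsep i j ij).
have miss_small g i : support g `&` N i = set0 -> small_elt g.
  move=> gi; apply: small_sub (Nout i) => b gb Nb.
  by have : set0 b by rewrite -gi.
have I0 : (0 < 8)%N by []. have I1 : (1 < 8)%N by []. have I2 : (2 < 8)%N by [].
have I3 : (3 < 8)%N by []. have I4 : (4 < 8)%N by []. have I5 : (5 < 8)%N by [].
have I6 : (6 < 8)%N by []. have I7 : (7 < 8)%N by [].
pose i0 := Ordinal I0; pose i1 := Ordinal I1; pose i2 := Ordinal I2; pose i3 := Ordinal I3.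
pose i4 := Ordinal I4; pose i5 := Ordinal I5; pose i6 := Ordinal I6; pose i7 := Ordinal I7.
(* Each of the four cells cut out by [s1] and [s2] contains two indices: whichever sides occur, two
   separated regions are met by both conjugates. *)
pose s1 := [:: i0; i1; i2; i3]; pose s2 := [:: i2; i3; i4; i5].
pose b1 := foldr (fun i g => (e i * g)%g) 1%g s1.
pose b2 := foldr (fun i g => (e i * g)%g) 1%g s2.
have B1 j : if j \in s1 then support b1 `&` N j !=set0 else support b1 `&` N j = set0.
  exact: (support_disjoint_prod (s := s1) e1 eN dis isT).
have B2 j : if j \in s2 then support b2 `&` N j !=set0 else support b2 `&` N j = set0.
  exact: (support_disjoint_prod (s := s2) e1 eN dis isT).
clearbody b1 b2.
(* The quotient [g^-1 g'] also misses [N i], so it is small, and it fixes [v]. *)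
have eq_of g g' i v : support g `&` N i = set0 -> support g' `&` N i = set0 ->
    aO g v = aO g' v -> g = g'.
  move=> gi g'i E; apply: (mulgI g^-1%g); rewrite mulVg; apply/esym/(free _ v).
    apply: (miss_small _ i); rewrite -subset0 => b [/supportM]; rewrite supportV => -[gb|gb] Nb.
      by rewrite -gi.
    by rewrite -g'i.
  by rewrite actM -E actgK.
have moved g i v : g <> 1%g -> support g `&` N i = set0 -> aO g v <> v.
  by move=> g1 gi gv; apply/g1/(free _ v) => //; exact: miss_small gi.
have eN0 i j : i != j -> support (e i) `&` N j = set0.
  by move=> ij; rewrite -subset0 => b [/eN Nb Nb']; exact: (dis i j b).
have b1n : b1 <> 1%g.
  by move=> E; have [b [[_]]] := B1 i0; rewrite E => + _; rewrite (act1 ab).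
have b2n : b2 <> 1%g.
  by move=> E; have [b [[_]]] := B2 i2; rewrite E => + _; rewrite (act1 ab).
have w01 : aO (e i0) w <> aO (e i1) w.
  move=> /(eq_of _ _ i2 w (eN0 i0 i2 isT) (eN0 i1 i2 isT)) E.
  have [b be] := support_neq0 (e1 i0); apply: (dis i0 i1 b isT); first exact: eN.
  by apply: eN; rewrite -E.
have w12 : aO b1 w <> aO b2 w.
  move=> /(eq_of _ _ i6 w (B1 i6) (B2 i6)) E.
  by have [b bb] := B2 i4; have : set0 b by rewrite -(B1 i4) E.
have [g [gw g0 g1]] := trans3 (nesym (moved _ i1 w (e1 i0) (eN0 i0 i1 isT)))
  (nesym (moved _ i0 w (e1 i1) (eN0 i1 i0 isT))) w01
  (nesym (moved _ i6 w b1n (B1 i6))) (nesym (moved _ i6 w b2n (B2 i6))) w12.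
have meets i bb : aO g (aO (e i) w) = aO bb w -> forall j j',
    support bb `&` N j !=set0 -> support bb `&` N j' = set0 ->
    [set ab g b | b in support (e i)] `&` N j !=set0 \/
    [set ab g b | b in support (e i)] `&` N j' !=set0.
  move=> gi j j' bj bj'; have [?|C] 
    := pselect ([set ab g b | b in support (e i)] `&` N j' !=set0); first by right.
  left; have {}C : support (g * (e i * g^-1))%g `&` N j' = set0.
    by apply: contrapT => /eqP/set0P; rewrite support_conj.
  rewrite -support_conj; have <- // : bb = (g * (e i * g^-1))%g.
  by apply: (eq_of _ _ j' w) => //; rewrite -gi !actM (fixedV gw).
have all_or (P : 'I_8 -> Prop) (A : pred 'I_8) :
    (forall j j', A j -> ~~ A j' -> P j \/ P j') ->
    (forall j, A j -> P j) \/ (forall j, ~~ A j -> P j).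
  move=> PA; have [?|/existsNP[j /not_implyP[Aj Pj]]]
    := pselect (forall j, A j -> P j); [by left|right].
  by move=> j' Aj'; have [] := PA j j' Aj Aj'.
have M0 := all_or _ _ (fun j j' (Aj : j \in s1) (Aj' : j' \notin s1) => meets _ _ g0 j j'
  ltac:(by have := B1 j; rewrite Aj) ltac:(by have := B1 j'; rewrite (negPf Aj'))).
have M1 := all_or _ _ (fun j j' (Aj : j \in s2) (Aj' : j' \notin s2) => meets _ _ g1 j j'
  ltac:(by have := B2 j; rewrite Aj) ltac:(by have := B2 j'; rewrite (negPf Aj'))).
have s01 := separated_act (g := g) (separated_sub (@eN i0) (@eN i1) (Nsep i0 i1 isT)).
have [p|p] := M0; have [q|q] := M1.
- exact: (separated_cross s01 (Nsep i2 i3 isT) (p i2 isT) (p i3 isT) (q i2 isT) (q i3 isT)).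
- exact: (separated_cross s01 (Nsep i0 i1 isT) (p i0 isT) (p i1 isT) (q i0 isT) (q i1 isT)).
- exact: (separated_cross s01 (Nsep i4 i5 isT) (p i4 isT) (p i5 isT) (q i4 isT) (q i5 isT)).
- exact: (separated_cross s01 (Nsep i6 i7 isT) (p i6 isT) (p i7 isT) (q i6 isT) (q i7 isT)).
Qed.

(** * The equivariant bijection onto an orbit *)

(** By 2-transitivity the stabilizer of [w] is maximal. A further element fixing [b] would make all
    of [G] fix [b], against the two loxodromic elements with disjoint fixed sets. *)
Lemma stab_eq w (b : boundary S) : limit_set aS b -> (forall h, stab w h -> ab h b = b) ->
  forall g, ab g b = b -> aO g w = w.
Proof.
move=> Xb fixb g gb; apply: contrapT => gw.
have [_ [g1 [g2 [_ _ g12]]]] := gT.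
have fixall h : ab h b = b.
  have [hw|hw] := pselect (aO h w = w); first exact: fixb.
  have [k [kw kv]] := trans2 (nesym gw) (nesym hw).
  have E : h = (k * (g * (g^-1 * (k^-1 * h))))%g by rewrite mulVKg mulVKg.
  rewrite E (actM ab) (actM ab) (fixb (g^-1 * _)%g) ?gb ?fixb//.
  by rewrite /stab /= !actM -kv !actgK.
have : set0 b by rewrite -g12; split; exact: fixall.
by [].
Qed.

Lemma fixed_conjugate w (b : limit_set aS) :
  (forall h, stab w h -> ab h (set_val b) = set_val b) ->
  conjugate_actions aOmega (orbit_action (limit_set_action aS) b).
Proof.
move=> fixb; have Xb : limit_set aS (set_val b) := set_valP b.
have stabP := stab_eq Xb fixb.
pose aX := limit_set_action aS.
(* [t v] is a chosen element carrying [w] to [v]. Equality of the stabilizers makes [t v b]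
   independent of the choice and the map injective. *)
have /boolp.choice[t tP] : forall v, exists g, aO g w = v by move=> v; exact: trans1.
have aXfix g : (aX g b = b) <-> (aO g w = w).
  split=> [E|gw]; first by apply: stabP; rewrite -[RHS](congr1 set_val E).
  by apply: val_inj; exact: fixb.
have aXeq g h : (aX g b = aX h b) <-> (aO g w = aO h w).
  split=> E.
    have /aXfix : aX (h^-1 * g)%g b = b by rewrite actM E actgK.
    by rewrite actM => /(congr1 (aO h)); rewrite actgKV.
  have /aXfix : aO (h^-1 * g)%g w = w by rewrite actM E actgK.
  by rewrite actM => /(congr1 (aX h)); rewrite actgKV.
have orb v : action_orbit aX b (aX (t v) b) by exists (t v).
pose f v : action_orbit aX b := exist _ (aX (t v) b) (mem_set (orb v)).
exists f; split; last first.
  move=> g v; apply: val_inj; change (aX (t (aO g v)) b = aX g (aX (t v) b)).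
  by rewrite -actM; apply/aXeq; rewrite actM !tP.
have fsurj (e : action_orbit aX b) : exists v, f v = e.
  have [g _ ge] := set_valP e; exists (aO g w); apply: val_inj => /=.
  by rewrite [RHS](esym ge); apply/aXeq; rewrite tP.
have /boolp.choice[f' f'P] := fsurj.
exists f' => [v|e]; last exact: f'P.
have /(congr1 val) /= /aXeq := f'P (f v).
by rewrite !tP.
Qed.

End Omega.
End Geometry.

Theorem theorem1p9 (R : realType) (S : metricType R) (G : groupType)
    (aS : isometric_action G S) (Omega : Type) (aOmega : group_action G Omega) :
  hyperbolic_space S ->
  general_type aS ->
  faithful_action (limit_set_action aS) ->
  ~ topologically_free (limit_set_action aS) ->
  faithful_action aOmega ->
  k_transitive 3 aOmega ->
  exists xi : limit_set aS,
    conjugate_actions aOmega (orbit_action (limit_set_action aS) xi).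
Proof.
move=> [_ [delta' d0 hypS]] gT faithX ntf faithO trans.
(* Enlarging the constant makes it positive, which gives the strict gaps used in the estimates. *)
pose delta := (delta' + 1)%R.
have delta_gt0 : (0 < delta)%R by apply: ltr_wpDl.
move/existsNP: ntf => [a /not_implyP[a1 /eqP/set0P[eta [U [oU Ueta] UF]]]].
have [p _] : exists p : S, True.
  have [x _ _] := boundary_classP (set_val eta).
  by exists (x 0%N).
have gromov_or x y z : (gromov_product p x y - delta <= gromov_product p x z)%R \/
    (gromov_product p y z - delta <= gromov_product p x z)%R.
  have := hypS x z y p; rewrite /delta.
  by case: (leP (gromov_product p x y) (gromov_product p y z)) => _ h; [left|right]; lra.
have faithX' g : (forall b, limit_set aS b -> boundary_action aS g b = b) -> g = 1%g.
  move=> gP; apply: faithX => b; apply: val_inj; exact: gP (set_valP b).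
(* [a] fixes a neighborhood of [eta] in the limit set pointwise, so its support misses a ball around
   [eta]. *)
have sa : small_elt aS p a.
  case: oU => V oV VU.
  have Veta : V (set_val eta) by move: Ueta; rewrite -VU.
  have [r _ rV] := oV _ Veta p.
  apply: (ball_small delta_gt0 gromov_or (eta := set_val eta) (r := r) (set_valP eta)) => b [Xb ab].
  move=> /rV Vb; apply: ab.
  have : U (exist _ b (mem_set Xb)) by rewrite -VU.
  by move=> /UF /(congr1 val).
have [w [_ [_ _]]] := three_points delta_gt0 gromov_or gT faithO.
have [[b Xb fixb]|pw] := stab_fixed_or_placeable delta_gt0 gromov_or gT faithO trans w.
  exists (exist _ b (mem_set Xb)).
  exact: (fixed_conjugate delta_gt0 gromov_or gT faithO trans (w := w)).
exfalso.
have [[g [v [sg g1 gv]]]|C] 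
  := pselect (exists g v, [/\ small_elt aS p g, g <> 1%g & aOmega g v = v]).
  exact: (small_fixed_contra delta_gt0 gromov_or gT faithX' faithO trans pw sg g1 gv).
have free g v : small_elt aS p g -> aOmega g v = v -> g = 1%g.
  by move=> sg gv; apply: contrapT => g1; apply: C; exists g, v.
exact: (small_free_contra faithX' trans pw sa a1 free).
Qed.
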